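(* Let $n\ge3$ and let $Z_n\subset S^1$ be the set of vertices of a regular $n$-gon. The clusters of the spaced-out cluster category $\mathcal C_{id}(Z_n)$ are in bijection with the triangulations of the regular $n$-gon with vertices being the elements of $Z_n$, where an edge $\overline{xy}$ is in the triangulation if and only if $E(x,y)$ is a member of the cluster.
   Context: Let $k$ be a field and $R=k[[t]]$. For $x,y\in S^1$ let $\angle(x,y)\in[0,2\pi)$ be the counterclockwise angle from $x$ to $y$. For $X\subseteq S^1$ put $c(x,y,z)=1$ if $\angle(x,y)+\angle(y,z)\ge2\pi$ and $c(x,y,z)=0$ otherwise. Let $RX$ be the category with objects $P_x$ ($x\in X$), $\operatorname{Hom}(P_x,P_y)=Rf_{xy}$ free of rank one, and $R$-bilinear composition with $f_{yz}f_{xy}=t^{c(x,y,z)}f_{xz}$. Let $\mathcal F(X)$ be the additive category generated by the indecomposable objects $E(x,y)=\left(P_x\oplus P_y,\ d=\begin{bmatrix}0&\beta\\ \alpha&0\end{bmatrix}\right)$, $x,y\in X$, where $\alpha:P_x\to P_y$, $\beta:P_y\to P_x$ satisfy $d^2=t$; morphisms $f:(P,d)\to(P',d')$ are maps $P\to P'$ with $fd=d'f$. The category $\mathcal F(X)$ is a Frobenius category (a sequence is exact when its underlying sequence of sums of the $P_x$ is split exact) whose indecomposable projective-injective objects are the $E(x,x)$, and $\mathcal C_{id}(X)$ is its stable (triangulated) category. For $X=Z_n=\{x_k=e^{2\pi ik/n}:k=1,\dots,n\}$ this is the spaced-out cluster category. Its indecomposable objects are, up to isomorphism, $E(x,y)\cong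 E(y,x)$ with $x\ne y$ in $Z_n$, and the shift satisfies $E(x,y)[1]=E(y,x)\cong E(x,y)$. Two nonisomorphic indecomposable objects $A,B$ are compatible if $\dim_k\operatorname{Ext}^1(A,B)+\dim_k\operatorname{Ext}^1(B,A)\le1$, where $\operatorname{Ext}^1(A,B)=\operatorname{Hom}(A,B[1])$ in $\mathcal C_{id}(Z_n)$. A cluster is a maximal collection of pairwise compatible (pairwise nonisomorphic) indecomposable objects of $\mathcal C_{id}(Z_n)$. The $n$ sides of the $n$-gon are counted as edges of every triangulation. *)

(* Defs.v *)
From HB Require Import structures.
From mathcomp Require Import all_boot all_order all_algebra.
From mathcomp Require Import all_classical all_reals all_analysis.
From mathcomp Require Import ring lra.

Set Implicit Arguments.
Unset Strict Implicit.
Unset Printing Implicit Defensive.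

Import Order.TTheory GRing.Theory Num.Theory.

Local Open Scope classical_set_scope.
Local Open Scope ring_scope.

Record fps (k : fieldType) := FPS { fcoef : nat -> k }.

Section PowerSeries.
Variable k : fieldType.
Implicit Types p q r : fps k.

Lemma fpsP p q : (forall n, fcoef p n = fcoef q n) -> p = q.
Proof. by case: p q => [p] [q] /= pq; congr FPS; apply/funext. Qed.

HB.instance Definition _ := gen_eqMixin (fps k).
HB.instance Definition _ := gen_choiceMixin (fps k).

Definition fps_zero : fps k := FPS (fun=> 0).
Definition fps_opp p := FPS (fun n => - fcoef p n).
Definition fps_add p q := FPS (fun n => fcoef p n + fcoef q n).

Fact fps_addA : associative fps_add.
Proof. by move=> p q r; apply: fpsP => n /=; rewrite addrA. Qed.
Fact fps_addC : commutative fps_add.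
Proof. by move=> p q; apply: fpsP => n /=; rewrite addrC. Qed.
Fact fps_add0 : left_id fps_zero fps_add.
Proof. by move=> p; apply: fpsP => n /=; rewrite add0r. Qed.
Fact fps_addN : left_inverse fps_zero fps_opp fps_add.
Proof. by move=> p; apply: fpsP => n /=; rewrite addNr. Qed.

HB.instance Definition _ := GRing.isZmodule.Build (fps k)
  fps_addA fps_addC fps_add0 fps_addN.

Definition fps_one : fps k := FPS (fun n => (n == 0)%N%:R).
Definition fps_mul p q :=
  FPS (fun n => \sum_(i < n.+1) fcoef p i * fcoef q (n - i)%N).

Definition fps_trunc m p : {poly k} := \poly_(i < m) fcoef p i.

Lemma fcoef_trunc m n p : (n < m)%N -> (fps_trunc m p)`_n = fcoef p n.
Proof. by move=> nm; rewrite coef_poly nm. Qed.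

Lemma fcoef_mul m n p q : (n < m)%N ->
  fcoef (fps_mul p q) n = (fps_trunc m p * fps_trunc m q)`_n.
Proof.
move=> nm; rewrite coefM; apply: eq_bigr => i _.
by rewrite !fcoef_trunc ?(leq_ltn_trans (leq_subr _ _)) ?(leq_ltn_trans (leq_ord i)).
Qed.

Fact fps_mulA : associative fps_mul.
Proof.
move=> p q r; apply: fpsP => n.
rewrite !(@fcoef_mul n.+1) //.
transitivity ((fps_trunc n.+1 p * (fps_trunc n.+1 q * fps_trunc n.+1 r))`_n).
  rewrite !coefM; apply: eq_bigr => i _; congr (_ * _).
  by rewrite fcoef_trunc ?ltnS ?leq_subr// (@fcoef_mul n.+1) ?ltnS ?leq_subr.
rewrite mulrA !coefM; apply: eq_bigr => i _; congr (_ * _).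
by rewrite fcoef_trunc// (@fcoef_mul n.+1).
Qed.
Fact fps_mulC : commutative fps_mul.
Proof. by move=> p q; apply: fpsP => n; rewrite !(@fcoef_mul n.+1)// mulrC. Qed.
Fact fps_mul1 : left_id fps_one fps_mul.
Proof.
move=> p; apply: fpsP => n /=; rewrite big_ord_recl /= mul1r subn0 big1 ?addr0//.
by move=> i _; rewrite mul0r.
Qed.
Fact fps_mulDl : left_distributive fps_mul fps_add.
Proof.
move=> p q r; apply: fpsP => n /=; rewrite -big_split /=.
by apply: eq_bigr => i _; rewrite mulrDl.
Qed.
Fact fps_one_neq0 : fps_one != 0.
Proof. by apply/eqP => /(congr1 (@fcoef k ^~ 0%N))/eqP /=; rewrite oner_eq0. Qed.

HB.instance Definition _ := GRing.Zmodule_isComNzRing.Build (fps k)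
  fps_mulA fps_mulC fps_mul1 fps_mulDl fps_one_neq0.

Definition fps_scale (a : k) p : fps k := FPS (fun n => a * fcoef p n).

Fact fps_scaleA a b p : fps_scale a (fps_scale b p) = fps_scale (a * b) p.
Proof. by apply: fpsP => n /=; rewrite mulrA. Qed.
Fact fps_scale1 : left_id 1 fps_scale.
Proof. by move=> p; apply: fpsP => n /=; rewrite mul1r. Qed.
Fact fps_scaleDr : right_distributive fps_scale +%R.
Proof. by move=> a p q; apply: fpsP => n /=; rewrite mulrDr. Qed.
Fact fps_scaleDl p : {morph fps_scale^~ p : a b / a + b}.
Proof. by move=> a b; apply: fpsP => n /=; rewrite mulrDl. Qed.

HB.instance Definition _ := GRing.Zmodule_isLmodule.Build k (fps k)
  fps_scaleA fps_scale1 fps_scaleDr fps_scaleDl.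

Definition fps_t : fps k := FPS (fun n => (n == 1)%N%:R).

End PowerSeries.

Notation circle R := {p : (R * R)%type | p.1 ^+ 2 + p.2 ^+ 2 == 1}.

Definition rot (R : realType) (a : R) (p : R * R) : R * R :=
  (cos a * p.1 - sin a * p.2, sin a * p.1 + cos a * p.2).

Definition angle (R : realType) (x y : circle R) : R :=
  xget 0 [set a | 0 <= a < 2 * pi /\ rot a (val x) = val y].

Definition cc (R : realType) (x y z : circle R) : nat :=
  (2 * pi <= angle x y + angle y z)%R.

Section Angle.
Variable R : realType.
Implicit Types x y z : circle R.

Lemma rotD (a b : R) p : rot (a + b) p = rot a (rot b p).
Proof. by rewrite /rot/= cosD sinD; congr pair; ring. Qed.

Lemma cos_eq1_02pi (a : R) : 0 <= a < 2 * pi -> cos a = 1 -> a = 0.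
Proof.
move=> /andP[a0 a2]; have p0 := pi_gt0 R.
have [api|api] := leP a pi.
  move=> c1; apply: cos_inj; rewrite ?in_itv/= ?a0 ?api ?lexx ?ltW//.
  by rewrite cos0.
move=> c1; have : 2 * pi - a = 0; last by lra.
apply: cos_inj; rewrite ?in_itv/=; [by lra|by lra|].
by rewrite cos0 mulr_natl addrC cosD2pi cosN.
Qed.

Lemma rot_inj x (a b : R) : 0 <= a < 2 * pi -> 0 <= b < 2 * pi ->
  rot a (val x) = rot b (val x) -> a = b.
Proof.
wlog ab : a b / a <= b.
  move=> H ha hb e; have [ab|/ltW ba] := leP a b; first exact: H.
  by apply/esym/H.
move=> ha hb; have -> : b = a + (b - a) by ring.
rewrite rotD; set c := b - a => e.
suff -> : c = 0 by rewrite addr0.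
apply: cos_eq1_02pi; first by rewrite /c; lra.
have {e} : rot c (val x) = val x.
  have := congr1 (rot (- a)) e; rewrite -!rotD ?addrA addNr add0r.
  by move=> <-; rewrite /rot cos0 sin0 !mul1r !mul0r subr0 add0r -surjective_pairing.
case: x => -[x1 x2] /= /eqP x12 [e1 e2].
have : cos c * (x1 ^+ 2 + x2 ^+ 2) = x1 ^+ 2 + x2 ^+ 2.
  transitivity (x1 * (cos c * x1 - sin c * x2) + x2 * (sin c * x1 + cos c * x2)).
    by ring.
  by rewrite e1 e2; ring.
by rewrite x12 mulr1.
Qed.

Lemma polar (p : R * R) : p.1 ^+ 2 + p.2 ^+ 2 = 1 ->
  exists2 a, 0 <= a < 2 * pi & p = (cos a, sin a).
Proof.
case: p => u v /= uv; have p0 := pi_gt0 R.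
have u1 : -1 <= u <= 1 by nra.
have c : cos (acos u) = u by rewrite acosK// in_itv.
have s : sin (acos u) = `|v|.
  by rewrite sin_acos// -uv addrC addKr sqrtr_sqr.
have g0 := acos_ge0 u1; have gp := acos_lepi u1.
have [v0|v0] := leP 0 v.
  by exists (acos u); rewrite ?c ?s ?ger0_norm//; lra.
have apos : 0 < acos u.
  rewrite lt_neqAle g0 andbT; apply/eqP => a0.
  by move: s; rewrite -a0 sin0 ltr0_norm//; lra.
exists (2 * pi - acos u); first by lra.
rewrite mulr_natl addrC cosD2pi sinD2pi cosN sinN c s ltr0_norm// opprK.
by [].
Qed.

Lemma angleP x y :
  0 <= angle x y < 2 * pi /\ rot (angle x y) (val x) = val y.
Proof.
rewrite /angle; case: xgetP => [a -> //|] H; exfalso.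
case: x y H => -[x1 x2] /= /eqP hx [[y1 y2] /= /eqP hy] H.
have [a a2 [e1 e2]] : exists2 a, 0 <= a < 2 * pi &
    (y1 * x1 + y2 * x2, y2 * x1 - y1 * x2) = (cos a, sin a).
  apply: polar => /=.
  transitivity ((x1 ^+ 2 + x2 ^+ 2) * (y1 ^+ 2 + y2 ^+ 2)); first by ring.
  by rewrite hx hy mulr1.
apply: (H a); split => //; rewrite /rot/= -e1 -e2; congr pair.
  by transitivity (y1 * (x1 ^+ 2 + x2 ^+ 2)); [ring|rewrite hx mulr1].
by transitivity (y2 * (x1 ^+ 2 + x2 ^+ 2)); [ring|rewrite hx mulr1].
Qed.

Lemma angleE x y (a : R) : 0 <= a < 2 * pi -> rot a (val x) = val y ->
  angle x y = a.
Proof.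
move=> ha e; have [h1 h2] := angleP x y.
by apply: (@rot_inj x) => //; rewrite h2 e.
Qed.

Lemma angleD x y z :
  angle x y + angle y z = angle x z + 2 * pi * (cc x y z)%:R.
Proof.
have p0 := pi_gt0 R.
have [a1 a2] := angleP x y; have [b1 b2] := angleP y z.
have r : rot (angle x y + angle y z) (val x) = val z.
  by rewrite addrC rotD a2 b2.
rewrite /cc; case: leP => h /=.
  rewrite mulr1 (@angleE x z (angle x y + angle y z - 2 * pi)) ?subrK//.
    by lra.
  rewrite addrC rotD r /rot cosN sinN mulr_natl cos2pi sin2pi.
  by case: (val z) => ? ? /=; congr pair; ring.
rewrite mulr0 addr0; apply/esym/angleE => //; lra.
Qed.

Lemma ccA x y z w : (cc x y z + cc x z w = cc y z w + cc x y w)%N.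
Proof.
apply/eqP; rewrite -(eqr_nat R); apply/eqP.
have : 2 * pi != 0 :> R by rewrite mulf_neq0// gt_eqF// pi_gt0.
move: (angleD x y z) (angleD x z w) (angleD y z w) (angleD x y w).
move: (2 * pi) => P h1 h2 h3 h4 /mulfI; apply.
rewrite !natrD; lra.
Qed.

Lemma anglexx x : angle x x = 0.
Proof.
apply: angleE; first by rewrite lexx mulr_gt0// pi_gt0.
by rewrite /rot cos0 sin0; case: (val x) => ? ? /=; congr pair; ring.
Qed.

Lemma ccxx x y : cc x x y = 0%N.
Proof.
rewrite /cc anglexx add0r; have [/andP[_ h] _] := angleP x y.
by rewrite leNgt h.
Qed.

Lemma ccyy x y : cc x y y = 0%N.
Proof.
rewrite /cc anglexx addr0; have [/andP[_ h] _] := angleP x y.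
by rewrite leNgt h.
Qed.

Lemma cc_neq x y : x != y -> cc x y x = 1%N.
Proof.
move=> xy; have := angleD x y x; rewrite /cc; case: leP => //= h.
rewrite anglexx add0r mulr0 => s.
have [/andP[h1 _] e] := angleP x y; have [/andP[h2 _] _] := angleP y x.
have a0 : angle x y = 0 by lra.
case/eqP: xy; apply: val_inj; rewrite -e a0 /rot cos0 sin0.
by case: (val x) => ? ? /=; congr pair; ring.
Qed.

End Angle.

Section Category.
Variables (R : realType) (k : fieldType) (X : set (circle R)).
Local Notation t := (fps_t k).

Record psum := PSum { pidx : finType; ppt : pidx -> X }.
Implicit Types P Q S : psum.

Definition pcc P Q S (i : pidx P) (j : pidx Q) (l : pidx S) : nat :=
  cc (val (ppt i)) (val (ppt j)) (val (ppt l)).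

(* The entry [f (j, i)] is the coefficient on f_xy of the component P_x -> P_y
   of [f], where x and y are the labels of the indices i and j. *)
Definition pmap P Q := {ffun pidx Q * pidx P -> fps k}.

Definition pcomp P Q S (g : pmap Q S) (f : pmap P Q) : pmap P S :=
  [ffun e => \sum_j t ^+ pcc e.2 j e.1 * (g (e.1, j) * f (j, e.2))].

Definition pid P : pmap P P := [ffun e => (e.1 == e.2)%:R].

Definition pscale P Q (a : fps k) (f : pmap P Q) : pmap P Q :=
  [ffun e => a * f e].

(* An object of F(X) is the direct sum of the E(x, y) with (x, y) = ends i,
   for i < nsummands; (i, false) and (i, true) index the summands
   P_x and P_y of E(x, y). *)
Record obj := Obj { nsummands : nat; ends : 'I_nsummands -> X * X }.
Implicit Types A B C I : obj.

Definition under A : psum := @PSum ('I_(nsummands A) * bool)%type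
  (fun i => if i.2 then (ends i.1).2 else (ends i.1).1).

(* On E(x, y): alpha = f_xy, and beta = f_yx if x <> y, beta = t f_xx if x = y.
   This is forced by d^2 = t up to isomorphism. *)
Definition diff A : pmap (under A) (under A) :=
  [ffun e : ('I_(nsummands A) * bool) * ('I_(nsummands A) * bool) =>
    if (e.1.1 == e.2.1) && (e.1.2 != e.2.2) then
      if e.2.2 && ((ends e.2.1).1 == (ends e.2.1).2) then t else 1
    else 0].

Definition E (x y : X) : obj := Obj (fun _ : 'I_1 => (x, y)).

Definition osum A B : obj := Obj (fun i : 'I_(nsummands A + nsummands B) =>
  match fintype.split i with inl a => ends a | inr b => ends b end).

Definition hom A B (f : pmap (under A) (under B)) :=
  pcomp f (diff A) = pcomp (diff B) f.

(* r and s split the underlying sequence in the additive hull of RX; they need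
   not commute with the differentials. *)
Definition conflation A B C (f : pmap (under A) (under B))
    (g : pmap (under B) (under C)) :=
  [/\ hom f, hom g &
    exists r s, [/\ pcomp r f = pid (under A), pcomp g s = pid (under C),
      pcomp g f = 0 & pcomp f r + pcomp s g = pid (under B)]].

Definition projective I :=
  forall A B C (f : pmap (under A) (under B)) (g : pmap (under B) (under C)),
  conflation f g ->
  forall h : pmap (under I) (under C), hom h ->
  exists h' : pmap (under I) (under B), hom h' /\ pcomp g h' = h.

Definition injective_obj I :=
  forall A B C (f : pmap (under A) (under B)) (g : pmap (under B) (under C)),
  conflation f g ->
  forall h : pmap (under A) (under I), hom h ->
  exists h' : pmap (under B) (under I), hom h' /\ pcomp h' f = h.

Definition null A B (f : pmap (under A) (under B)) :=
  exists I (g : pmap (under A) (under I)) (h : pmap (under I) (under B)),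
  [/\ projective I, injective_obj I, hom g, hom h & f = pcomp h g].

(* In C_id(X) = F(X) / null, the morphisms A -> B are the maps satisfying [hom],
   and two of them are equal if their difference is [null]. *)
Definition stable_iso A B :=
  exists (f : pmap (under A) (under B)) (g : pmap (under B) (under A)),
  [/\ hom f, hom g, null (pcomp g f - pid (under A)) &
      null (pcomp f g - pid (under B))].

Definition stable_zero A := null (pid (under A)).

Definition indecomposable A := ~ stable_zero A /\
  forall B C, stable_iso A (osum B C) -> stable_zero B \/ stable_zero C.

Definition stable_hom_dim A B (d : nat) :=
  exists b : 'I_d -> pmap (under A) (under B), (forall i, hom (b i)) /\
  forall f, hom f -> exists! c : 'rV[k]_d, null (f - \sum_i c 0 i *: b i).

(* E(x, y)[1] = E(y, x); see [shift_conflation]. *)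
Definition shift A : obj := Obj (fun i : 'I_(nsummands A) => ((ends i).2, (ends i).1)).

Definition ext1_dim A B d := stable_hom_dim A (shift B) d.

Definition compatible A B := exists d1 d2,
  [/\ ext1_dim A B d1, ext1_dim B A d2 & (d1 + d2 <= 1)%N].

(* A collection of isomorphism classes of objects is represented by the
   isomorphism-closed set of all their members. *)
Definition compatible_collection (C : set obj) :=
  [/\ C `<=` indecomposable,
      forall A B, C A -> stable_iso A B -> C B &
      forall A B, C A -> C B -> ~ stable_iso A B -> compatible A B].

Definition is_cluster (C : set obj) := compatible_collection C /\
  forall D, compatible_collection D -> C `<=` D -> D = C.

Lemma pcompA P Q S T (h : pmap S T) (g : pmap Q S) (f : pmap P Q) :
  pcomp h (pcomp g f) = pcomp (pcomp h g) f.
Proof.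
apply/ffunP => -[l i]; rewrite !ffunE /=.
under eq_bigr => s _ do rewrite ffunE /= !mulr_sumr.
rewrite exchange_big /=; apply: eq_bigr => j _.
rewrite ffunE /= mulr_suml mulr_sumr; apply: eq_bigr => s _.
have := ccA (val (ppt i)) (val (ppt j)) (val (ppt s)) (val (ppt l)).
rewrite -!/(pcc _ _ _) => e.
rewrite ![t ^+ _ * _]mulrC !mulrA -!mulrA.
rewrite [t ^+ _ * (f _ * _)]mulrCA -!exprD addnC -e.
by rewrite addnC.
Qed.

Lemma pcompDl P Q S (g g' : pmap Q S) (f : pmap P Q) :
  pcomp (g + g') f = pcomp g f + pcomp g' f.
Proof.
apply/ffunP => e; rewrite !ffunE -big_split; apply: eq_bigr => j _ /=.
by rewrite ffunE mulrDl mulrDr.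
Qed.

Lemma pcompDr P Q S (g : pmap Q S) (f f' : pmap P Q) :
  pcomp g (f + f') = pcomp g f + pcomp g f'.
Proof.
apply/ffunP => e; rewrite !ffunE -big_split; apply: eq_bigr => j _ /=.
by rewrite ffunE !mulrDr.
Qed.

Lemma pcompNl P Q S (g : pmap Q S) (f : pmap P Q) :
  pcomp (- g) f = - pcomp g f.
Proof.
apply/ffunP => e; rewrite !ffunE -sumrN; apply: eq_bigr => j _ /=.
by rewrite ffunE mulNr mulrN.
Qed.

Lemma pcompNr P Q S (g : pmap Q S) (f : pmap P Q) :
  pcomp g (- f) = - pcomp g f.
Proof.
apply/ffunP => e; rewrite !ffunE -sumrN; apply: eq_bigr => j _ /=.
by rewrite ffunE !mulrN.
Qed.

Lemma pcomp0l P Q S (f : pmap P Q) : pcomp (0 : pmap Q S) f = 0.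
Proof.
by apply/ffunP => e; rewrite !ffunE big1// => j _; rewrite ffunE mul0r mulr0.
Qed.

Lemma pcomp0r P Q S (g : pmap Q S) : pcomp g (0 : pmap P Q) = 0.
Proof.
by apply/ffunP => e; rewrite !ffunE big1// => j _; rewrite ffunE !mulr0.
Qed.

Lemma pcompZl P Q S a (g : pmap Q S) (f : pmap P Q) :
  pcomp (pscale a g) f = pscale a (pcomp g f).
Proof.
apply/ffunP => e; rewrite !ffunE mulr_sumr; apply: eq_bigr => j _ /=.
by rewrite ffunE -mulrA mulrCA.
Qed.

Lemma pcompZr P Q S a (g : pmap Q S) (f : pmap P Q) :
  pcomp g (pscale a f) = pscale a (pcomp g f).
Proof.
apply/ffunP => e; rewrite !ffunE mulr_sumr; apply: eq_bigr => j _ /=.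
by rewrite ffunE [RHS]mulrCA; congr (_ * _); rewrite mulrCA.
Qed.

(* The map with components a i * f_xx : P_x -> P_x from index i to index u i. *)
Definition mono P Q (u : pidx P -> pidx Q) (a : pidx P -> fps k) : pmap P Q :=
  [ffun e => if e.1 == u e.2 then a e.2 else 0].

Lemma pcomp_mono P Q S (u : pidx P -> pidx Q) a (g : pmap Q S) :
  (forall i, ppt (u i) = ppt i) ->
  pcomp g (mono u a) = [ffun e => g (e.1, u e.2) * a e.2].
Proof.
move=> uP; apply/ffunP => -[l i]; rewrite !ffunE /= (bigD1 (u i))//= big1.
  by rewrite ffunE /= eqxx /pcc uP ccxx expr0 mul1r addr0.
by move=> j /negPf ji; rewrite ffunE /= ji !mulr0.
Qed.

Lemma mono_pcomp P Q S (u : pidx Q -> pidx S) (v : pidx S -> pidx Q) a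
    (f : pmap P Q) :
  (forall i, ppt (u i) = ppt i) -> cancel u v -> cancel v u ->
  pcomp (mono u a) f = [ffun e => a (v e.1) * f (v e.1, e.2)].
Proof.
move=> uP uv vu; apply/ffunP => -[l i]; rewrite !ffunE /= (bigD1 (v l))//= big1.
  rewrite ffunE /= vu eqxx /pcc.
  have -> : ppt l = ppt (v l) by rewrite -uP vu.
  by rewrite ccyy expr0 mul1r addr0.
move=> j jl; rewrite ffunE /=; case: eqP => [lj|_]; last by rewrite mul0r mulr0.
by rewrite lj uv eqxx in jl.
Qed.

Lemma pidE P : pid P = mono id (fun=> 1).
Proof. by apply/ffunP => e; rewrite !ffunE; case: eqP. Qed.

Lemma pcomp_idr P Q (f : pmap P Q) : pcomp f (pid P) = f.
Proof.
by rewrite pidE pcomp_mono//; apply/ffunP => -[j i]; rewrite ffunE mulr1.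
Qed.

Lemma pcomp_idl P Q (f : pmap P Q) : pcomp (pid Q) f = f.
Proof.
by rewrite pidE (mono_pcomp _ _ (v := id))//; apply/ffunP => -[j i];
  rewrite ffunE mul1r.
Qed.

Lemma diff2 A : pcomp (diff A) (diff A) = pscale t (pid (under A)).
Proof.
apply/ffunP => -[[l b] [i c]]; rewrite !ffunE /=.
rewrite (bigD1 (i, ~~ c))//= big1 ?addr0; last first.
  move=> [j b'] /= jc; rewrite !ffunE /=; case: (eqVneq j i) => [ji|_] /=.
    subst j; case: (eqVneq b' c) => [_|b'c] /=; first by rewrite !mulr0.
    by case/negP: jc; apply/eqP; congr pair; case: b' c b'c => -[].
  by rewrite !mulr0.
rewrite !ffunE /= eqxx [~~ c != c](_ : _ = true) /=; last by case: (c).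
rewrite xpair_eqE; case: (eqVneq l i) => [->|_] /=; last by rewrite mul0r !mulr0.
have -> : (b != ~~ c) = (b == c) by case: b c => -[].
case: (eqVneq b c) => [->|_] /=; last by rewrite mul0r !mulr0.
rewrite mulr1 /pcc /=; set x := (ends i).1; set y := (ends i).2.
have [xy|xy] := eqVneq x y.
  by rewrite -xy; case: c; rewrite /= ccxx expr0 mul1r ?mulr1 ?mul1r.
have vxy : val x != val y by apply: contra xy => /eqP/val_inj/eqP.
by rewrite !andbF !mulr1; case: c => /=; rewrite cc_neq// eq_sym.
Qed.

(* The sum of the E(x, x), for P_x ranging over the summands of P. *)
Definition double P : obj := 
  Obj (fun i : 'I_#|pidx P| => (ppt (enum_val i), ppt (enum_val i))).

Definition din P (b : bool) : pmap P (under (double P)) :=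
  @mono P (under (double P)) (fun i => (enum_rank i, b)) (fun=> 1).
Definition dout P (b : bool) : pmap (under (double P)) P :=
  [ffun e : pidx P * ('I_#|pidx P| * bool) => (e.2 == (enum_rank e.1, b))%:R].

Lemma ppt_double P i : 
  @ppt (under (double P)) i = ppt (enum_val i.1).
Proof. by rewrite /=; case: ifP. Qed.

Lemma pcomp_din P Q b (g : pmap (under (double P)) Q) :
  pcomp g (din P b) = [ffun e => g (e.1, (enum_rank e.2, b))].
Proof.
rewrite pcomp_mono; last by move=> i; rewrite ppt_double /= enum_rankK.
by apply/ffunP => -[j i]; rewrite !ffunE mulr1.
Qed.

Lemma pcomp_dout P Q b (f : pmap Q (under (double P))) :
  pcomp (dout P b) f = [ffun e => f ((enum_rank e.1, b), e.2)].
Proof.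
apply/ffunP => -[l i]; rewrite !ffunE /= (bigD1 (enum_rank l, b))//= big1.
  rewrite ffunE /= eqxx /pcc ppt_double /= enum_rankK ccyy expr0 !mul1r addr0//.
by move=> j /negPf jl; rewrite ffunE /= jl mul0r mulr0.
Qed.

Lemma doutin P b : pcomp (dout P b) (din P b) = pid P.
Proof.
rewrite pcomp_din; apply/ffunP => -[j i]; rewrite !ffunE /=.
by rewrite xpair_eqE eqxx andbT eq_sym (inj_eq enum_rank_inj).
Qed.

Lemma doutin0 P b : pcomp (dout P b) (din P (~~ b)) = 0.
Proof.
rewrite pcomp_din; apply/ffunP => -[j i]; rewrite !ffunE /=.
by rewrite xpair_eqE; case: b; rewrite andbF.
Qed.

Lemma din_dout P Q b (g : pmap P Q) :
  pcomp g (dout P b) =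
  [ffun e : pidx Q * ('I_#|pidx P| * bool) =>
    if e.2.2 == b then g (e.1, enum_val e.2.1) else 0].
Proof.
apply/ffunP => -[l [i c]]; rewrite !ffunE /=.
rewrite (bigD1 (enum_val i))//= big1 => [|j ji].
  rewrite ffunE /= addr0 enum_valK xpair_eqE eqxx /= /pcc /= if_same.
  by rewrite ccxx expr0 mul1r; case: eqP; rewrite ?mulr1 ?mulr0.
rewrite ffunE /= xpair_eqE; case: eqP => [ij|_]; last by rewrite !mulr0.
by rewrite ij enum_rankK eqxx in ji.
Qed.

Lemma pid_double P : pid (under (double P)) =
  pcomp (din P false) (dout P false) + pcomp (din P true) (dout P true).
Proof.
apply/ffunP => -[[j c] [i b]]; rewrite !din_dout !ffunE /= !xpair_eqE enum_valK.
by case: b; case: c; case: (j == i); rewrite /= ?addr0 ?add0r.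
Qed.

Lemma diff_double P : diff (double P) =
  pcomp (din P true) (dout P false) +
  pscale t (pcomp (din P false) (dout P true)).
Proof.
apply/ffunP => -[[j c] [i b]]; rewrite !din_dout !ffunE /= !xpair_eqE enum_valK eqxx.
by case: b; case: c; case: (j == i);
  rewrite /= ?mulr0 ?mulr1 ?addr0 ?add0r.
Qed.

Lemma double_ext P Q (f g : pmap (under (double P)) Q) :
  (forall b, pcomp f (din P b) = pcomp g (din P b)) -> f = g.
Proof.
move=> fg; rewrite -[f]pcomp_idr -[g]pcomp_idr pid_double.
by rewrite !pcompDr !pcompA !fg.
Qed.

Lemma double_coext P Q (f g : pmap Q (under (double P))) :
  (forall b, pcomp (dout P b) f = pcomp (dout P b) g) -> f = g.
Proof.
move=> fg; rewrite -[f]pcomp_idl -[g]pcomp_idl pid_double.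
by rewrite !pcompDl -!pcompA !fg.
Qed.

Lemma pscale0 P Q a : pscale a (0 : pmap P Q) = 0.
Proof. by apply/ffunP => e; rewrite !ffunE mulr0. Qed.

Lemma diff_din P : pcomp (diff (double P)) (din P false) = din P true.
Proof.
rewrite diff_double pcompDl pcompZl -!pcompA doutin (doutin0 P true).
by rewrite pcomp_idr pcomp0r pscale0 addr0.
Qed.

Lemma diff_din' P :
  pcomp (diff (double P)) (din P true) = pscale t (din P false).
Proof.
rewrite diff_double pcompDl pcompZl -!pcompA doutin (doutin0 P false).
by rewrite pcomp_idr pcomp0r add0r.
Qed.

Lemma dout_diff P : pcomp (dout P true) (diff (double P)) = dout P false.
Proof.
rewrite diff_double pcompDr pcompZr !pcompA doutin (doutin0 P true).
by rewrite pcomp_idl pcomp0l pscale0 addr0.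
Qed.

Lemma dout_diff' P :
  pcomp (dout P false) (diff (double P)) = pscale t (dout P true).
Proof.
rewrite diff_double pcompDr pcompZr !pcompA doutin (doutin0 P false).
by rewrite pcomp_idl pcomp0l add0r.
Qed.

Lemma double_projective P : projective (double P).
Proof.
move=> A B C f g [hf hg [r [s [rf gs gf fr]]]] h hh.
have [u gu] : exists u, pcomp g u = pcomp h (din P false).
  by exists (pcomp s (pcomp h (din P false))); rewrite pcompA gs pcomp_idl.
exists (pcomp u (dout P false) + pcomp (diff B) (pcomp u (dout P true))).
set h' := (X in hom X).
have h'0 : pcomp h' (din P false) = u.
  rewrite /h' pcompDl -!pcompA doutin (doutin0 P true) !pcomp0r addr0.
  by rewrite pcomp_idr.
have h'1 : pcomp h' (din P true) = pcomp (diff B) u.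
  rewrite /h' pcompDl -!pcompA doutin (doutin0 P false) !pcomp0r add0r.
  by rewrite pcomp_idr.
split; apply: double_ext => -[].
- rewrite -!pcompA diff_din' h'1 pcompZr h'0 pcompA diff2 pcompZl.
  by rewrite pcomp_idl.
- by rewrite -!pcompA diff_din h'1 h'0.
- rewrite -pcompA h'1 pcompA hg -pcompA gu -diff_din !pcompA.
  by rewrite hh.
- by rewrite -pcompA h'0.
Qed.

Lemma double_injective P : injective_obj (double P).
Proof.
move=> A B C f g [hf hg [r [s [rf gs gf fr]]]] h hh.
have [u uf] : exists u, pcomp u f = pcomp (dout P true) h.
  by exists (pcomp (dout P true) (pcomp h r)); rewrite -!pcompA rf pcomp_idr.
exists (pcomp (din P false) (pcomp u (diff B)) + pcomp (din P true) u).
set h' := (X in hom X).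
have h'0 : pcomp (dout P false) h' = pcomp u (diff B).
  rewrite /h' pcompDr !pcompA doutin (doutin0 P false) !pcomp0l addr0.
  by rewrite pcomp_idl.
have h'1 : pcomp (dout P true) h' = u.
  rewrite /h' pcompDr !pcompA doutin (doutin0 P true) !pcomp0l add0r.
  by rewrite pcomp_idl.
split; apply: double_coext => -[].
- by rewrite !pcompA dout_diff h'1 h'0.
- rewrite !pcompA dout_diff' h'0 pcompZl h'1 -pcompA diff2 pcompZr.
  by rewrite pcomp_idr.
- by rewrite pcompA h'1.
- rewrite pcompA h'0 -pcompA -hf pcompA uf -pcompA hh pcompA.
  by rewrite dout_diff.
Qed.

Definition twist A (i : 'I_(nsummands A) * bool) : 'I_(nsummands A) * bool :=
  (i.1, if (ends i.1).1 == (ends i.1).2 then i.2 else ~~ i.2).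

Lemma twistK A : involutive (@twist A).
Proof. by case=> i b; rewrite /twist /=; case: eqP => //= _; rewrite negbK. Qed.

Lemma twist_ppt A i : @ppt (under (shift A)) (@twist A i) = @ppt (under A) i.
Proof. by case: i => i [] /=; case: eqP => /=. Qed.

Definition sig A : pmap (under A) (under (shift A)) :=
  @mono (under A) (under (shift A)) (@twist A) (fun i => (-1) ^+ i.2).
Definition sig' A : pmap (under (shift A)) (under A) :=
  @mono (under (shift A)) (under A) (@twist A) (fun i => (-1) ^+ (@twist A i).2).

Lemma sigK A : pcomp (sig A) (sig' A) = pid (under (shift A)).
Proof.
rewrite pcomp_mono => [|i]; last by case: i => i []; rewrite /twist /=; case: eqP.
apply/ffunP => -[j i]; rewrite !ffunE /= !twistK; case: eqP => _; last first.
  by rewrite mul0r.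
by rewrite -signr_addb addbb.
Qed.

Lemma sig'K A : pcomp (sig' A) (sig A) = pid (under A).
Proof.
rewrite pcomp_mono => [|i]; last exact: twist_ppt.
apply/ffunP => -[j i]; rewrite !ffunE /= !twistK; case: eqP => _; last first.
  by rewrite mul0r.
by case: (_ == _); rewrite ?negbK -signr_addb addbb.
Qed.

Lemma sig_diff A : pcomp (sig A) (diff A) = - pcomp (diff (shift A)) (sig A).
Proof.
rewrite (@mono_pcomp (under A) (under A) (under (shift A)) _ (@twist A));
  [|exact: twist_ppt|exact: (@twistK A)..].
rewrite pcomp_mono; last exact: twist_ppt.
apply/ffunP => -[[j c] [i b]]; rewrite !ffunE /=.
rewrite /twist /=; case: (eqVneq j i) => [->|_] /=;
  last by rewrite mulr0 mul0r oppr0.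
rewrite [(ends i).2 == _]eq_sym; case: eqP => _ /=; case: b; case: c => /=;
  by rewrite ?expr0 ?expr1 ?mulr0 ?mul0r ?mulr1 ?mul1r ?mulN1r ?mulrN1 ?oppr0
    ?opprK.
Qed.

(* The conflation A -> I -> A[1] that defines the shift in the stable
   category. *)
Lemma shift_conflation A :
  exists I (f : pmap (under A) (under I)) (g : pmap (under I) (under (shift A))),
  [/\ projective I, injective_obj I & conflation f g].
Proof.
pose P := under A; exists (double P).
exists (pcomp (din P false) (diff A) + din P true).
exists (pcomp (sig A) (dout P false - pcomp (diff A) (dout P true))).
set f := (X in conflation X _); set g := (X in conflation _ X).
have fE : f = pcomp (din P false) (diff A) + din P true by [].
have gE : g = pcomp (sig A) (dout P false - pcomp (diff A) (dout P true)) by [].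
clearbody f g.
have f0 : pcomp (dout P false) f = diff A.
  by rewrite fE pcompDr pcompA doutin (doutin0 P false) pcomp_idl addr0.
have f1 : pcomp (dout P true) f = pid P.
  by rewrite fE pcompDr pcompA doutin (doutin0 P true) pcomp0l add0r.
have g0 : pcomp g (din P false) = sig A.
  rewrite gE -pcompA pcompDl pcompNl -pcompA doutin (doutin0 P true).
  by rewrite pcomp0r subr0 pcomp_idr.
have g1 : pcomp g (din P true) = - pcomp (sig A) (diff A).
  rewrite gE -pcompA pcompDl pcompNl -pcompA doutin (doutin0 P false).
  by rewrite pcomp_idr sub0r pcompNr.
have sd : pcomp (diff (shift A)) (sig A) = - pcomp (sig A) (diff A).
  by rewrite sig_diff opprK.
split; [exact: double_projective|exact: double_injective|split].
- apply: double_coext => -[]; rewrite !pcompA ?dout_diff ?dout_diff'.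
    by rewrite f1 f0 pcomp_idl.
  by rewrite f0 pcompZl f1 diff2.
- apply: double_ext => -[]; rewrite -!pcompA ?diff_din ?diff_din'.
    rewrite pcompZr g0 g1 pcompNr pcompA sd pcompNl opprK -pcompA diff2.
    by rewrite pcompZr pcomp_idr.
  by rewrite g1 g0 sd.
exists (dout P true), (pcomp (din P false) (sig' A)); split => //.
- by rewrite pcompA g0 sigK.
- by rewrite gE -pcompA pcompDl pcompNl f0 -pcompA f1 pcomp_idr subrr pcomp0r.
- rewrite fE gE pcompDl -!pcompA [pcomp (sig' A) _]pcompA sig'K pcomp_idl.
  rewrite pcompDr pcompNr pid_double -addrA addrCA [RHS]addrC; congr (_ + _).
  by rewrite addrC subrK.
Qed.

End Category.

Arguments E {R X} x y.
Arguments is_cluster {R} k {X} C.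

Definition Zn_pt (R : realType) (n j : nat) : circle R :=
  exist _ (cos (2 * pi * j%:R / n%:R), sin (2 * pi * j%:R / n%:R))
    (introT eqP (cos2Dsin2 (2 * pi * j%:R / n%:R))).

Definition Zn (R : realType) (n : nat) : set (circle R) :=
  [set @Zn_pt R n j | j in [set j | (1 <= j <= n)%N]].

Arguments Zn_pt : clear implicits.
Arguments Zn : clear implicits.

Section Polygon.
Variables (R : realType) (X : set (circle R)).

(* An edge is represented by the set of its two end points. *)
Definition edge : set (set X) :=
  [set e | exists x y : X, x <> y /\ e = [set x; y]].

Definition open_segment (e : set X) : set (R * R) :=
  [set p | exists (x y : X) (s : R),
    [/\ x <> y, e = [set x; y], 0 < s < 1 &
        p = ((1 - s) * (val (val x)).1 + s * (val (val y)).1,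
             (1 - s) * (val (val x)).2 + s * (val (val y)).2)]].

Definition crossing (e e' : set X) :=
  e <> e' /\ open_segment e `&` open_segment e' !=set0.

Definition noncrossing (T : set (set X)) :=
  T `<=` edge /\ forall e e', T e -> T e' -> ~ crossing e e'.

(* The edges include the sides of the polygon, which cross no edge and hence
   belong to every triangulation. *)
Definition triangulation (T : set (set X)) := noncrossing T /\
  forall T', noncrossing T' -> T `<=` T' -> T' = T.

End Polygon.

(* Main.v *)
(* In the stable category the zero morphisms are exactly the boundaries u d + d u:
   a map killed by passing to an injective object factors through the canonical
   embedding of its source into a sum of objects E(x, x). Hence
   Hom(E(x, y), E(z, w)) is the cohomology of an explicit 2x2 complex over k[[t]],
   and comparing powers of t shows that it has dimension at most one, with equality
   if and only if exactly one of z, w lies in the half-open arc from x to y. For two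
   different edges this holds in both directions exactly when their indices
   interleave, that is, when the chords cross; so compatible means noncrossing.
   Indecomposable objects being the E(x, y) with x <> y, compatible collections
   correspond to noncrossing edge sets, and the correspondence respects inclusion,
   hence maximality. *)
From mathcomp Require Import all_boot all_order all_algebra.
From mathcomp Require Import all_classical all_reals all_analysis.
From mathcomp Require Import ring lra zify.
Require Import Defs.

Set Implicit Arguments.
Unset Strict Implicit.
Unset Printing Implicit Defensive.

Import Order.TTheory GRing.Theory Num.Theory.

Local Open Scope ring_scope.

(** * The stable category *)

Section StableCategory.
Variables (R : realType) (k : fieldType) (X : set (circle R)).
Implicit Types (P Q S : psum X) (A B C : obj X).
Local Notation d A := (diff k A).
Local Notation id_ A := (pid k (under A)).
Local Notation map A B := (pmap k (under A) (under B)).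

(** A morphism out of [double P] is determined by its restriction [u] to the [false] copy of [P],
    and its composite with the canonical embedding [i] of A is u d + d u. A null map extends along
    [i] because it factors through an injective object. *)
Lemma null_boundary A B (f : map A B) :
  null f <-> exists u, f = pcomp u (d A) + pcomp (d B) u.
Proof.
set P := under A; set D := double P.
pose i : map A D := pcomp (din k P false) (d A) + din k P true.
have hE (Q : obj X) (v : map D Q) : hom v ->
    pcomp v i = pcomp (pcomp v (din k P false)) (d A)
              + pcomp (d Q) (pcomp v (din k P false)).
  by move=> hv; rewrite pcompDr -(diff_din k P) !pcompA hv.
have i0 : pcomp (dout k P false) i = d A.
  by rewrite pcompDr pcompA doutin (doutin0 k P false) pcomp_idl addr0.
have i1 : pcomp (dout k P true) i = pid k P.
  by rewrite pcompDr pcompA doutin (doutin0 k P true) pcomp0l add0r.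
have hi : hom i.
  apply: double_coext => -[]; rewrite !pcompA ?dout_diff ?dout_diff'.
    by rewrite i1 i0 pcomp_idl.
  by rewrite i0 pcompZl i1 diff2.
split=> [[I [g [h [_ injI hg hh ->]]]]|[u ->]].
  (* The cokernel projection of [i], as in [shift_conflation], introduced through an equation so
     that it stays opaque. *)
  have [p pE] : exists p : map D (shift A),
      p = pcomp (sig k A) (dout k P false - pcomp (d A) (dout k P true)).
    by eexists.
  have p0 : pcomp p (din k P false) = sig k A.
    rewrite pE -pcompA pcompDl pcompNl -pcompA doutin (doutin0 k P true).
    by rewrite pcomp0r subr0 pcomp_idr.
  have p1 : pcomp p (din k P true) = - pcomp (sig k A) (d A).
    rewrite pE -pcompA pcompDl pcompNl -pcompA doutin (doutin0 k P false).
    by rewrite pcomp_idr sub0r pcompNr.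
  have sd : pcomp (d (shift A)) (sig k A) = - pcomp (sig k A) (d A).
    by rewrite sig_diff opprK.
  have conf : conflation i p.
    split=> //.
      apply: double_ext => -[]; rewrite -!pcompA ?diff_din ?diff_din'.
        rewrite pcompZr p0 p1 pcompNr pcompA sd pcompNl opprK -pcompA.
        by rewrite diff2 pcompZr pcomp_idr.
      by rewrite p1 p0 sd.
    exists (dout k P true), (pcomp (din k P false) (sig' k A)); split=> //.
    - by rewrite pcompA p0 sigK.
    - by rewrite pE -pcompA pcompDl pcompNl i0 -pcompA i1 pcomp_idr subrr pcomp0r.
    rewrite pE pcompDl -!pcompA [pcomp (sig' k A) _]pcompA sig'K pcomp_idl.
    rewrite pcompDr pcompNr pid_double -addrA addrCA [RHS]addrC; congr (_ + _).
    by rewrite addrC subrK.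
  (* Injectivity of [I] extends [g] along [i], and [hE] then applies to the composite of [h] and
     [g']. *)
  have [g' [hg' <-]] := injI _ _ _ _ _ conf _ hg.
  exists (pcomp (pcomp h g') (din k P false)); rewrite pcompA hE //.
  by rewrite /hom -pcompA hg' !pcompA hh.
(* The morphism out of [D] whose restriction to the [false] copy is [u]. *)
pose h : map D B := pcomp u (dout k P false) + pcomp (d B) (pcomp u (dout k P true)).
have h0 : pcomp h (din k P false) = u.
  rewrite pcompDl -!pcompA doutin (doutin0 k P true) !pcomp0r addr0.
  by rewrite pcomp_idr.
have hh : hom h.
  rewrite /hom pcompDl -!pcompA dout_diff dout_diff' pcompDr pcompZr.
  by rewrite [X in _ = _ + X]pcompA diff2 pcompZl pcomp_idl addrC.
exists D, i, h.
by split=> //; [exact: double_projective|exact: double_injective|rewrite hE ?h0].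
Qed.

(** Views a scalar of k as a constant power series, so that bilinearity of composition over k[[t]]
    applies to it. *)
Lemma scale_pscale P Q (a : k) (f : pmap k P Q) :
  a *: f = pscale (a *: (1 : fps k)) f.
Proof.
apply/ffunP => e; rewrite !ffunE; apply: fpsP => n /=.
rewrite big_ord_recl subn0 /= mulr1 big1 ?addr0 // => i _.
by rewrite mulr0 mul0r.
Qed.

(** * Null morphisms and isomorphism in the stable category *)

Lemma hom_id A : hom (id_ A).
Proof. by rewrite /hom pcomp_idl pcomp_idr. Qed.

Lemma hom_comp A B C (g : map B C) (f : map A B) :
  hom g -> hom f -> hom (pcomp g f).
Proof. by move=> hg hf; rewrite /hom -pcompA hf !pcompA hg. Qed.

Lemma homD A B (f g : map A B) : hom f -> hom g -> hom (f + g).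
Proof. by rewrite /hom pcompDl pcompDr => -> ->. Qed.

Lemma homZ A B a (f : map A B) : hom f -> hom (a *: f).
Proof. by rewrite /hom scale_pscale pcompZl pcompZr => ->. Qed.

Lemma homB A B (f g : map A B) : hom f -> hom g -> hom (f - g).
Proof. by move=> hf hg; rewrite -scaleN1r; apply/homD/homZ. Qed.

Lemma null0 A B : null (0 : map A B).
Proof. by apply/null_boundary; exists 0; rewrite pcomp0l pcomp0r addr0. Qed.

Lemma nullD A B (f g : map A B) : null f -> null g -> null (f + g).
Proof.
move=> /null_boundary[u ->] /null_boundary[v ->]; apply/null_boundary.
by exists (u + v); rewrite pcompDl pcompDr addrACA.
Qed.

Lemma nullZ A B a (f : map A B) : null f -> null (a *: f).
Proof.
move=> /null_boundary[u ->]; apply/null_boundary; exists (a *: u).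
by rewrite scalerDr !scale_pscale pcompZl pcompZr.
Qed.

Lemma nullN A B (f : map A B) : null f -> null (- f).
Proof. by rewrite -scaleN1r; apply: nullZ. Qed.

Lemma nullB A B (f g : map A B) : null f -> null g -> null (f - g).
Proof. by move=> nf /nullN; apply: nullD. Qed.

Lemma null_compl A B C (g : map B C) (f : map A B) :
  hom g -> null f -> null (pcomp g f).
Proof.
move=> hg /null_boundary[u ->]; apply/null_boundary; exists (pcomp g u).
by rewrite pcompDr !pcompA hg.
Qed.

Lemma null_compr A B C (g : map B C) (f : map A B) :
  hom f -> null g -> null (pcomp g f).
Proof.
move=> hf /null_boundary[u ->]; apply/null_boundary; exists (pcomp u f).
by rewrite pcompDl -!pcompA hf.
Qed.

Definition steq A B (f g : map A B) := null (f - g).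

Lemma steq_sym A B (f g : map A B) : steq f g -> steq g f.
Proof. by move/nullN; rewrite opprB. Qed.

Lemma steq_trans A B (f g h : map A B) : steq f g -> steq g h -> steq f h.
Proof. by move=> fg gh; have := nullD fg gh; rewrite addrA subrK. Qed.

Lemma steq_compl A B C (h : map B C) (f g : map A B) :
  hom h -> steq f g -> steq (pcomp h f) (pcomp h g).
Proof. by move=> hh /(null_compl hh); rewrite pcompDr pcompNr. Qed.

Lemma steq_compr A B C (f g : map B C) (h : map A B) :
  hom h -> steq f g -> steq (pcomp f h) (pcomp g h).
Proof. by move=> hh /(null_compr hh); rewrite pcompDl pcompNl. Qed.

Lemma steq_null A B (f g : map A B) : steq f g -> null g -> null f.
Proof. by move=> fg ng; have := nullD fg ng; rewrite subrK. Qed.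

Lemma steq_cancel A B C (f : map A B) (g : map B A) (h : map C A) :
  hom h -> steq (pcomp g f) (id_ A) -> steq (pcomp g (pcomp f h)) h.
Proof. by move=> hh /(steq_compr hh); rewrite pcomp_idl -pcompA. Qed.

Lemma stable_iso_refl A : stable_iso k A A.
Proof.
exists (id_ A), (id_ A); split; [exact: hom_id|exact: hom_id|..];
  by rewrite pcomp_idl subrr; apply: null0.
Qed.

Lemma stable_iso_sym A B : stable_iso k A B -> stable_iso k B A.
Proof. by move=> [f [g []]]; exists g, f. Qed.

Lemma stable_iso_trans B A C :
  stable_iso k A B -> stable_iso k B C -> stable_iso k A C.
Proof.
have comp_inv A' B' C' (f : map A' B') g (f' : map B' C') g' :
    hom f -> hom g -> steq (pcomp g f) (id_ A') ->
    steq (pcomp g' f') (id_ B') ->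
    steq (pcomp (pcomp g g') (pcomp f' f)) (id_ A').
  move=> hf hg gf gf'; apply: steq_trans gf.
  by rewrite -pcompA; apply: steq_compl => //; apply: steq_cancel.
move=> [f [g [hf hg gf fg]]] [f' [g' [hf' hg' gf' fg']]].
exists (pcomp f' f), (pcomp g g'); split; try exact: hom_comp.
  exact: comp_inv.
exact: comp_inv.
Qed.

(** Conjugation by [sig] identifies A with its shift. As [sig] anticommutes with the differentials,
    the signs cancel on morphisms, and a homotopy [u] is carried to minus its conjugate. *)
Lemma stable_iso_shift A B : stable_iso k A B -> stable_iso k (shift A) (shift B).
Proof.
pose Sh A B (f : map A B) : map (shift A) (shift B) :=
  pcomp (sig k B) (pcomp f (sig' k A)).
have sig'_diff A' : pcomp (d A') (sig' k A') = - pcomp (sig' k A') (d (shift A')).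
  rewrite -[LHS]pcomp_idl -(sig'K k A') -!pcompA [pcomp _ (pcomp (d A') _)]pcompA.
  by rewrite sig_diff pcompNl pcompNr -!pcompA sigK pcomp_idr.
have Shd A' B' (f : map A' B') :
    Sh _ _ (pcomp f (d A')) = - pcomp (Sh _ _ f) (d (shift A')).
  by rewrite /Sh -!pcompA sig'_diff !pcompNr.
have dSh A' B' (f : map A' B') :
    Sh _ _ (pcomp (d B') f) = - pcomp (d (shift B')) (Sh _ _ f).
  by rewrite /Sh !pcompA sig_diff !pcompNl.
have homSh A' B' (f : map A' B') : hom f -> hom (Sh _ _ f).
  by move=> hf; apply: oppr_inj; rewrite -Shd hf dSh.
have nullSh A' B' (f : map A' B') : null f -> null (Sh _ _ f).
  move=> /null_boundary[u ->]; apply/null_boundary; exists (- Sh _ _ u).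
  by rewrite pcompNl pcompNr -Shd -dSh /Sh pcompDl pcompDr.
have ShV A' B' (f : map A' B') g : null (pcomp g f - id_ A') ->
    null (pcomp (Sh _ _ g) (Sh _ _ f) - id_ (shift A')).
  move=> /nullSh; rewrite /Sh pcompDl pcompDr pcompNl pcompNr pcomp_idl sigK.
  by rewrite -!pcompA [pcomp (sig' _ _) (pcomp _ _)]pcompA sig'K pcomp_idl.
move=> [f [g [hf hg gf fg]]]; exists (Sh _ _ f), (Sh _ _ g).
by split; [exact: homSh|exact: homSh|exact: ShV|exact: ShV].
Qed.

Lemma stable_zero_iso A B : stable_iso k A B -> stable_zero k A -> stable_zero k B.
Proof.
move=> [f [g [hf hg gf fg]]] zA; apply: steq_null (steq_sym fg) _.
by rewrite -[g]pcomp_idl; apply/null_compl/null_compr.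
Qed.

Lemma indecomposable_iso A B :
  stable_iso k A B -> indecomposable k A -> indecomposable k B.
Proof.
move=> AB [nzA iA]; split=> [/(stable_zero_iso (stable_iso_sym AB))//|C D BCD].
exact/iA/(stable_iso_trans AB).
Qed.

(** The basis is transported along the isomorphisms; the coordinates of [h] are those of g' h f in
    the old basis. *)
Lemma stable_hom_dim_iso A A' B B' n : stable_iso k A A' -> stable_iso k B B' ->
  stable_hom_dim k A B n -> stable_hom_dim k A' B' n.
Proof.
move=> [f [f' [hf hf' ff' f'f]]] [g [g' [hg hg' gg' g'g]]] [b [hb bP]].
exists (fun i => pcomp g (pcomp (b i) f')); split=> [i|h hh].
  by apply/hom_comp/hom_comp.
have sumE (c : 'rV[k]_n) : \sum_i c 0 i *: pcomp g (pcomp (b i) f') =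
    pcomp g (pcomp (\sum_i c 0 i *: b i) f').
  elim/big_rec2: _ => [|i u v _ ->]; first by rewrite pcomp0l pcomp0r.
  by rewrite pcompDl pcompDr !scale_pscale pcompZl pcompZr.
have hsum (c : 'rV[k]_n) : hom (\sum_i c 0 i *: b i).
  elim/big_rec: _ => [|i u _ hu]; first by rewrite /hom pcomp0l pcomp0r.
  exact/homD/hu/homZ.
have [c [cP cU]] := bP (pcomp g' (pcomp h f)) (hom_comp hg' (hom_comp hh hf)).
exists c; split=> [|c' c'P]; last apply: cU.
  apply: steq_sym; rewrite sumE.
  apply: (@steq_trans _ _ _ (pcomp g (pcomp (pcomp g' (pcomp h f)) f'))).
    by apply: steq_compl => //; apply: steq_compr => //; apply: steq_sym.
  rewrite -!pcompA; apply: steq_trans (steq_cancel _ g'g) _.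
    by apply: hom_comp => //; apply: hom_comp.
  by rewrite -[X in steq _ X]pcomp_idr; apply: steq_compl.
move: c'P; rewrite sumE => c'P.
apply: (@steq_trans _ _ _
  (pcomp g' (pcomp (pcomp g (pcomp (\sum_i c' 0 i *: b i) f')) f))).
  by apply: steq_compl => //; apply: steq_compr.
rewrite -!pcompA; apply: steq_trans (steq_cancel _ gg') _.
  by apply: hom_comp => //; apply: hom_comp.
by rewrite -[X in steq _ X]pcomp_idr; apply: steq_compl.
Qed.

Lemma ext1_dim_iso A A' B B' n : stable_iso k A A' -> stable_iso k B B' ->
  ext1_dim k A B n -> ext1_dim k A' B' n.
Proof. by move=> AA' /stable_iso_shift; apply: stable_hom_dim_iso. Qed.

Lemma compatible_iso A A' B B' : stable_iso k A A' -> stable_iso k B B' ->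
  compatible k A B -> compatible k A' B'.
Proof.
move=> AA' BB' [n1 [n2 [e1 e2 n12]]]; exists n1, n2.
by split=> //; [exact: ext1_dim_iso e1|exact: ext1_dim_iso e2].
Qed.

(** * Direct sums and stable decompositions *)

Definition comono P Q (u : pidx Q -> pidx P) : pmap k P Q :=
  [ffun e => (e.2 == u e.1)%:R].

Lemma comono_pcomp P Q S (u : pidx Q -> pidx P) (f : pmap k S P) :
  (forall i, ppt (u i) = ppt i) ->
  pcomp (comono u) f = [ffun e => f (u e.1, e.2)].
Proof.
move=> uP; apply/ffunP => -[l i]; rewrite !ffunE /= (bigD1 (u l)) //= big1.
  by rewrite ffunE /= eqxx /pcc uP ccyy expr0 !mul1r addr0.
by move=> j /negPf jl; rewrite ffunE /= jl mul0r mulr0.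
Qed.

Lemma osum_biproduct B C : exists (i : map B (osum B C)) (p : map (osum B C) B)
    (j : map C (osum B C)) (q : map (osum B C) C),
  [/\ hom i, hom p, hom j & hom q] /\
  [/\ pcomp p i = id_ B, pcomp q j = id_ C & pcomp i p + pcomp j q = id_ (osum B C)].
Proof.
set O := osum B C.
pose il (l : pidx (under B)) : pidx (under O) := (lshift _ l.1, l.2).
pose ir (l : pidx (under C)) : pidx (under O) := (rshift _ l.1, l.2).
have el l : ends (o := O) (lshift _ l) = ends l.
  by rewrite /= (unsplitK (inl l)).
have er l : ends (o := O) (rshift _ l) = ends l.
  by rewrite /= (unsplitK (inr l)).
have pl l : @ppt _ _ (under O) (il l) = @ppt _ _ (under B) l.
  by rewrite -[LHS]/(if l.2 then _ else _) el.
have pr l : @ppt _ _ (under O) (ir l) = @ppt _ _ (under C) l.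
  by rewrite -[LHS]/(if l.2 then _ else _) er.
have lr l m : (il l == ir m) = false.
  by rewrite xpair_eqE /= eq_lrshift.
have rl l m : (ir l == il m) = false.
  by rewrite xpair_eqE /= eq_rlshift.
(* Maps into the sum are compared through their two projections. *)
have coext S (f g : pmap k S (under O)) :
    pcomp (comono il) f = pcomp (comono il) g ->
    pcomp (comono ir) f = pcomp (comono ir) g -> f = g.
  rewrite !comono_pcomp // => fgl fgr; apply/ffunP => -[[l b] m].
  rewrite -(splitK l); case: (fintype.split l) => l' /=.
    by have /ffunP/(_ ((l', b), m)) := fgl; rewrite !ffunE.
  by have /ffunP/(_ ((l', b), m)) := fgr; rewrite !ffunE.
pose i : map B O := mono (P := under B) (Q := under O) il (fun=> 1).
pose j : map C O := mono (P := under C) (Q := under O) ir (fun=> 1).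
pose p : map O B := comono (P := under O) (Q := under B) il.
pose q : map O C := comono (P := under O) (Q := under C) ir.
have pi : pcomp p i = id_ B.
  rewrite comono_pcomp //; apply/ffunP => -[[l b] [m c]].
  by rewrite !ffunE /= !xpair_eqE (inj_eq (@lshift_inj _ _)); case: ifP.
have qj : pcomp q j = id_ C.
  rewrite comono_pcomp //; apply/ffunP => -[[l b] [m c]].
  by rewrite !ffunE /= !xpair_eqE (inj_eq (@rshift_inj _ _)); case: ifP.
have pj : pcomp p j = 0.
  by rewrite comono_pcomp //; apply/ffunP => e; rewrite !ffunE lr.
have qi : pcomp q i = 0.
  by rewrite comono_pcomp //; apply/ffunP => e; rewrite !ffunE rl.
(* The differential of the sum is block diagonal, which makes the inclusions and projections
   morphisms. *)
have pdi : pcomp p (pcomp (d O) i) = d B.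
  rewrite comono_pcomp // pcomp_mono //; apply/ffunP => -[[l b] [m c]].
  by rewrite !ffunE mulr1 /il !el /= (inj_eq (@lshift_inj _ _)).
have qdj : pcomp q (pcomp (d O) j) = d C.
  rewrite comono_pcomp // pcomp_mono //; apply/ffunP => -[[l b] [m c]].
  by rewrite !ffunE mulr1 /ir !er /= (inj_eq (@rshift_inj _ _)).
have pdj : pcomp p (pcomp (d O) j) = 0.
  rewrite comono_pcomp // pcomp_mono //; apply/ffunP => -[[l b] [m c]].
  by rewrite !ffunE mulr1 /= eq_lrshift.
have qdi : pcomp q (pcomp (d O) i) = 0.
  rewrite comono_pcomp // pcomp_mono //; apply/ffunP => -[[l b] [m c]].
  by rewrite !ffunE mulr1 /= eq_rlshift.
have ipjq : pcomp i p + pcomp j q = id_ O.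
  apply: coext; rewrite -/p -/q pcomp_idr pcompDr !pcompA.
    by rewrite pi pj pcomp_idl pcomp0l addr0.
  by rewrite qi qj pcomp_idl pcomp0l add0r.
clearbody i j p q.
exists i, p, j, q; do 2!split=> //.
- rewrite /hom -[RHS]pcomp_idl -ipjq pcompDl -!pcompA pdi qdi.
  by rewrite pcomp0r addr0.
- rewrite /hom -[LHS]pcomp_idr -ipjq pcompDr -!pcompA.
  rewrite [pcomp (d O) (pcomp i p)]pcompA [pcomp (d O) (pcomp j q)]pcompA.
  by rewrite [X in X + _]pcompA pdi [X in _ + X]pcompA pdj pcomp0l addr0.
- rewrite /hom -[RHS]pcomp_idl -ipjq pcompDl -!pcompA pdj qdj.
  by rewrite pcomp0r add0r.
rewrite /hom -[LHS]pcomp_idr -ipjq pcompDr -!pcompA.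
rewrite [pcomp (d O) (pcomp i p)]pcompA [pcomp (d O) (pcomp j q)]pcompA.
by rewrite [X in X + _]pcompA qdi [X in _ + X]pcompA qdj pcomp0l add0r.
Qed.

(** The idempotent j q factors through the zero object C, so i p is stably the identity. *)
Lemma osum_zeror B C : stable_zero k C -> stable_iso k (osum B C) B.
Proof.
move=> zC; have [i [p [j [q [[hi hp hj hq] [pi qj ipjq]]]]]] := osum_biproduct B C.
exists p, i; split=> //; last by rewrite pi subrr; apply: null0.
rewrite -ipjq opprD addNKr; apply: nullN.
by rewrite -[q]pcomp_idl; apply/null_compl/null_compr.
Qed.

Lemma osum_zerol B C : stable_zero k B -> stable_iso k (osum B C) C.
Proof.
move=> zB; have [i [p [j [q [[hi hp hj hq] [pi qj ipjq]]]]]] := osum_biproduct B C.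
exists q, j; split=> //; last by rewrite qj subrr; apply: null0.
rewrite -ipjq addrC opprD addrNK; apply: nullN.
by rewrite -[p]pcomp_idl; apply/null_compl/null_compr.
Qed.

Lemma pcomp_E x y P Q (g : pmap k (under (E x y)) Q)
    (f : pmap k P (under (E x y))) l i :
  let F b := fps_t k ^+ cc (val (ppt i)) (val (if b then y else x)) (val (ppt l)) *
    (g (l, (ord0, b)) * f ((ord0, b), i)) in
  pcomp g f (l, i) = F true + F false.
Proof.
move=> F; rewrite ffunE /= (eq_bigr (fun j => F j.2)) => [|[j b] _].
  by rewrite -(pair_bigA _ (fun _ b => F b)) /= big_ord1 big_bool.
by rewrite ord1.
Qed.

(** Only the return component of the differential carries t; the component from [false] to [true] is
    invertible, and its inverse is a contracting homotopy. *)
Lemma Exx_stable_zero (x : X) : stable_zero k (E x x).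
Proof.
apply/null_boundary.
pose u b c : fps k := (~~ b && c)%:R.
exists [ffun e => u e.1.2 e.2.2].
apply/ffunP => -[[l b] [m c]]; rewrite !ord1 ffunE [RHS]ffunE !pcomp_E.
rewrite !ffunE /= !eqxx /= !if_same ccxx expr0 !mul1r.
by case: b; case: c; rewrite /u /= ?(mulr0, mul0r, mulr1, addr0, add0r).
Qed.

(** Induction on the number of summands: split off the first one. Indecomposability makes it or the
    remaining sum stably zero, and that part is discarded. A surviving E(x, y) has distinct ends by
    [Exx_stable_zero]. *)
Lemma indecomposable_E A :
  indecomposable k A -> exists x y : X, x <> y /\ stable_iso k A (E x y).
Proof.
elim: {A}(nsummands A) {-2}A (erefl (nsummands A)) => [|n IH] [m e] /= mn;
  subst m; move=> [nz ind].
  by case: nz; rewrite /stable_zero (_ : pid _ _ = 0); [exact: null0|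
    apply/ffunP => -[[[]]]].
set A := Obj e in nz ind *.
pose A' := Obj (fun i : 'I_n => e (rshift 1 i)).
have [x [y exy]] : exists x y, e ord0 = (x, y) by case: (e ord0) => x y; exists x, y.
have AE : A = osum (E x y) A'.
  rewrite /A /osum /=; congr Obj; apply/funext => i.
  rewrite -[i in LHS](@splitK 1 n); case: (fintype.split _) => l //=.
  by rewrite -exy; congr e; apply: val_inj; case: l => -[].
have Aiso : stable_iso k A (osum (E x y) A').
  by rewrite -AE; apply: stable_iso_refl.
have [z|z] := ind _ _ Aiso; last first.
  have iA : stable_iso k A (E x y) by rewrite AE; apply: osum_zeror.
  exists x, y; split=> // xy; apply/nz/(stable_zero_iso (stable_iso_sym iA)).
  by rewrite xy; apply: Exx_stable_zero.
have iA : stable_iso k A A' by rewrite AE; apply: osum_zerol.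
have [x' [y' [xy' iA']]] := IH A' erefl (indecomposable_iso iA (conj nz ind)).
by exists x', y'; split=> //; apply: stable_iso_trans iA'.
Qed.

End StableCategory.

(** * Morphisms between the E(x, y) *)

Section PowerSeriesLemmas.
Variable k : fieldType.
Implicit Types a e p : fps k.
Local Notation t := (fps_t k).

Lemma fcoef_tM p n : fcoef (t * p) n = if n is n'.+1 then fcoef p n' else 0.
Proof.
rewrite [fcoef _ _]/=; case: n => [|n].
  by rewrite big_ord_recl big_ord0 mul0r addr0.
rewrite 2!big_ord_recl big1 => [|i _]; last by rewrite mul0r.
by rewrite mul0r mul1r add0r addr0 subn1.
Qed.

Lemma fps_tI a e : t * a = t * e -> a = e.
Proof.
move=> ae; apply: fpsP => n; have := congr1 (fun p => fcoef p n.+1) ae.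
by rewrite !fcoef_tM.
Qed.

Lemma fps_split p : exists q, p = fcoef p 0 *: (1 : fps k) + t * q.
Proof.
exists (FPS (fun n => fcoef p n.+1)); set q := FPS _; apply: fpsP => n.
rewrite -[RHS]/(fcoef (_ *: (1 : fps k)) n + fcoef (t * q) n) fcoef_tM.
by case: n => [|n]; rewrite /= ?mulr1 ?addr0 ?mulr0 ?add0r.
Qed.

(* [a] and [e] are the coefficients of a morphism between two E(x, y), and the
   exponents are values of [cc]; [b] and [c] are the coefficients of a homotopy. *)
Lemma fps_homotopy (p p' q q' r r' s s' : nat) a e :
  (p + r = 1)%N -> (p' + r' = 1)%N -> (q + s = 1)%N -> (q' + s' = 1)%N ->
  (0 < p + p')%N ->
  t ^+ p * a = t ^+ q * e -> t ^+ p' * e = t ^+ q' * a ->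
  exists b c, a = t ^+ r * c + t ^+ s' * b /\ e = t ^+ r' * b + t ^+ s * c.
Proof.
(* If m = 1, then m' = 0 gives v = t u directly, and m' = 1 gives v = u after cancelling t. *)
have H m m' l u v : m = 1%N -> (m' + l = 1)%N ->
    t ^+ m * u = t ^+ m' * v -> v = t ^+ l * u.
  move=> ->; rewrite expr1; case: m' => [|[|//]] /=; rewrite ?add0n.
    by move=> ->; rewrite expr0 mul1r expr1 => <-.
  by case: l => // _; rewrite expr1 => /fps_tI ->; rewrite mul1r.
(* Either p = 1, so r = 0 and the homotopy (0, a) works, or p' = 1, so r' = 0 and (e, 0) works. *)
move=> pr p'r' qs q's' pp' h h'; have [pE|pE] := eqVneq p 1%N.
  have r0 : r = 0%N by lia.
  by exists 0, a; rewrite !mulr0 addr0 add0r -(H _ _ _ _ _ pE qs h) r0 mul1r.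
have p'E : p' = 1%N by lia.
have r'0 : r' = 0%N by lia.
by exists e, 0; rewrite !mulr0 addr0 add0r -(H _ _ _ _ _ p'E q's' h') r'0 mul1r.
Qed.

End PowerSeriesLemmas.

Section HomE.
Variables (R : realType) (k : fieldType) (X : set (circle R)).
Implicit Types (x y z w : X).
Local Notation t := (fps_t k).
Local Notation map A B := (pmap k (under A) (under B)).
Local Notation c x y z := (cc (val x) (val y) (val z)).

(** The cocycle identity at x, z, w, z: going from z to w and back is one full turn. *)
Lemma cc_addr (x z w : circle R) : z != w -> (cc x z w + cc x w z = 1)%N.
Proof. by move=> zw; have := ccA x z w z; rewrite ccyy cc_neq //; lia. Qed.

Lemma cc_addl (x y w : circle R) : x != y -> (cc x y w + cc y x w = 1)%N.
Proof. by move=> xy; have := ccA x y x w; rewrite ccxx cc_neq //; lia. Qed.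

Section Hom.
Variables x y z w : X.
Hypotheses (xy : x != y) (zw : z != w).
Local Notation "f _[ a , b ]" := (f ((ord0, a), (ord0, b))) (at level 10).

Lemma val_neq (a b : X) : a != b -> val a != val b.
Proof. by apply: contra => /eqP/val_inj/eqP. Qed.

Lemma pcomp_diff_E (f : map (E x y) (E z w)) b b' :
  pcomp f (diff k (E x y)) _[b', b] =
    t ^+ c (if b then y else x) (if b then x else y) (if b' then w else z) *
    f _[b', ~~ b].
Proof.
rewrite pcomp_E !ffunE /= (negPf xy) andbF.
by case: b; rewrite /= !(mulr0, mulr1, addr0, add0r).
Qed.

Lemma diff_pcomp_E (f : map (E x y) (E z w)) b b' :
  pcomp (diff k (E z w)) f _[b', b] =
    t ^+ c (if b then y else x) (if b' then z else w) (if b' then w else z) *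
    f _[~~ b', b].
Proof.
rewrite pcomp_E !ffunE /= (negPf zw).
by case: b'; rewrite /= !(mul0r, mulr0, mul1r, addr0, add0r).
Qed.

(** The equations decouple: the first two involve only the diagonal coefficients, the last two only
    the off-diagonal ones. The boundaries in [null_E] decouple in the same way. *)
Lemma hom_E (f : map (E x y) (E z w)) : hom f <->
  [/\ t ^+ c x z w * f _[false, false] = t ^+ c x y w * f _[true, true],
      t ^+ c y w z * f _[true, true] = t ^+ c y x z * f _[false, false],
      t ^+ c x w z * f _[true, false] = t ^+ c x y z * f _[false, true] &
      t ^+ c y z w * f _[false, true] = t ^+ c y x w * f _[true, false]].
Proof.
split=> [hf|[h1 h2 h3 h4]].
  by split; [have := pcomp_diff_E f false true|have := pcomp_diff_E f true false|
    have := pcomp_diff_E f false false|have := pcomp_diff_E f true true];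
    rewrite hf diff_pcomp_E.
apply/ffunP => -[[l b'] [i b]]; rewrite !ord1 pcomp_diff_E diff_pcomp_E.
by case: b; case: b'.
Qed.

Lemma null_E (f : map (E x y) (E z w)) : null f <->
  exists u00 u01 u10 u11,
  [/\ f _[false, false] = t ^+ c x w z * u10 + t ^+ c x y z * u01,
      f _[true, true] = t ^+ c y z w * u01 + t ^+ c y x w * u10,
      f _[true, false] = t ^+ c x z w * u00 + t ^+ c x y w * u11 &
      f _[false, true] = t ^+ c y w z * u11 + t ^+ c y x z * u00].
Proof.
split=> [/null_boundary[u fE]|[u00 [u01 [u10 [u11 [h1 h2 h3 h4]]]]]].
  exists (u _[false, false]), (u _[false, true]), (u _[true, false]), (u _[true, true]).
  by split; rewrite fE ffunE pcomp_diff_E diff_pcomp_E addrC.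
apply/null_boundary; exists [ffun e => if e.1.2 then if e.2.2 then u11 else u10
  else if e.2.2 then u01 else u00].
apply/ffunP => -[[l b'] [i b]]; rewrite !ord1 [RHS]ffunE pcomp_diff_E diff_pcomp_E.
by rewrite !ffunE addrC; case: b; case: b'.
Qed.

(** Each positivity hypothesis makes every cycle of one of the two blocks a boundary, by
    [fps_homotopy]. *)
Lemma hom_E_null (f : map (E x y) (E z w)) :
  (0 < c x z w + c y w z)%N -> (0 < c x w z + c y z w)%N -> hom f -> null f.
Proof.
move=> D1 D2 /hom_E[h1 h2 h3 h4]; apply/null_E.
have yx : y != x by rewrite eq_sym.
have wz : w != z by rewrite eq_sym.
have [b [e [-> ->]]] := fps_homotopy (cc_addr (val x) (val_neq zw))
  (cc_addr (val y) (val_neq wz)) (cc_addl (val w) (val_neq xy))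
  (cc_addl (val z) (val_neq yx)) D1 h1 h2.
have [b' [e' [-> ->]]] := fps_homotopy (cc_addr (val x) (val_neq wz))
  (cc_addr (val y) (val_neq zw)) (cc_addl (val z) (val_neq xy))
  (cc_addl (val w) (val_neq yx)) D2 h3 h4.
by exists e', b, e, b'.
Qed.

Definition Ediag : map (E x y) (E z w) := [ffun e => (e.1.2 == e.2.2)%:R].

(** The two vanishing exponents determine all the others. Diagonal cycles are then pairs (a, a)
    modulo multiples of t, a copy of k spanned by [Ediag], while every off-diagonal cycle is a
    boundary. *)
Lemma hom_Ediag : c x z w = 0%N -> c y w z = 0%N ->
  hom Ediag /\ forall f : map (E x y) (E z w), hom f ->
  exists! a : k, null (f - a *: Ediag).
Proof.
move=> p p'.
have e1 := cc_addr (val x) (val_neq zw); have e2 := cc_addr (val y) (val_neq zw).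
have e3 := cc_addl (val z) (val_neq xy); have e4 := cc_addl (val w) (val_neq xy).
(* With c(x,w,z) = 1 and c(y,w,z) = 0, this cocycle identity forces c(x,y,w) = 0 and c(x,y,z) =
   1. *)
have e5 := ccA (val x) (val y) (val w) (val z).
have [q q'] : c x y w = 0%N /\ c y x z = 0%N by clear - p p' e1 e3 e5; lia.
have [r r'] : c x w z = 1%N /\ c y x w = 1%N by clear - p q e1 e4; lia.
have [s s'] : c x y z = 1%N /\ c y z w = 1%N by clear - p' q' e2 e3; lia.
clear e1 e2 e3 e4 e5.
have hE : hom Ediag.
  apply/hom_E; rewrite !ffunE /= !mulr0; split=> //.
    by rewrite p q.
  by rewrite p' q'.
split=> // f hf.
(* Diagonal entries of boundaries are divisible by t, so the constant term detects [a]. *)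
have key (a : k) : null (a *: Ediag) -> a = 0.
  move=> /null_E[u00 [u01 [u10 [u11 [+ _ _ _]]]]]; rewrite !ffunE r s -mulrDr.
  by move=> /(congr1 (fun p => fcoef p 0)); rewrite expr1 fcoef_tM /= mulr1.
move: hf => /hom_E[]; rewrite p q p' q' r r' s s' !mul1r => f01 _ /fps_tI f10 _.
(* The coordinate is the constant term of the diagonal coefficient; the remainder t g is a
   boundary. *)
have [g gE] := fps_split (f _[false, false]).
set a := fcoef _ _ in gE.
have na : null (f - a *: Ediag).
  apply/null_E; exists (f _[true, false]), 0, g, 0.
  rewrite !ffunE /= -f01 gE -f10 r r' s s' p p' q q' !mulr0 !mul1r.
  by rewrite !addr0 !add0r scaler0 oppr0 addr0 expr1 addrAC subrr add0r.
exists a; split=> // a' na'; apply/eqP; rewrite -subr_eq0; apply/eqP/key.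
by have := nullB na' na; rewrite scalerBl opprB addrC subrKA.
Qed.

Lemma stable_hom_dim_E : c x z w = 0%N -> c y w z = 0%N ->
  stable_hom_dim k (E x y) (E z w) 1.
Proof.
move=> p p'; have [hE fE] := hom_Ediag p p'.
exists (fun=> Ediag); split=> // f /fE[a [na ua]].
have sE (b : 'rV[k]_1) : \sum_i b 0 i *: Ediag = b 0 0 *: Ediag.
  by rewrite big_ord1.
exists (a%:M); split=> [|b]; rewrite sE; first by rewrite mxE eqxx mulr1n.
by move=> /ua ->; rewrite -mx11_scalar.
Qed.

Lemma stable_hom_dim0 (A B : obj X) : (forall f : map A B, hom f -> null f) ->
  stable_hom_dim k A B 0.
Proof.
move=> hnull; exists (fun=> 0); split=> [[]//|f hf]; exists 0.
split=> [|b _]; first by rewrite big_ord0 subr0; apply: hnull.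
by apply/rowP => -[].
Qed.

End Hom.

Lemma Ediag_id x y : Ediag x y x y = pid k (under (E x y)).
Proof.
by apply/ffunP => -[[l b] [m c]]; rewrite !ffunE /= !ord1 xpair_eqE eqxx.
Qed.

(** The stable endomorphism ring is k, whose only idempotents are 0 and 1; a decomposition yields an
    idempotent that kills one of its summands. *)
Lemma indecomposable_Exy x y : x != y -> indecomposable k (E x y).
Proof.
move=> xy; have := @hom_Ediag x y x y xy xy; rewrite Ediag_id ccxx ccxx.
case=> // _ End; set id_E := pid k _ in End.
have nz : ~ stable_zero k (E x y).
  move=> z; have [a [_ ua]] := End _ (hom_id k (E x y)).
  (* If the identity were null, every scalar would be its coordinate. *)
  have ua1 b : a = b by apply: ua; apply/nullB/nullZ.
  by have /eqP := ua1 0; rewrite (ua1 1) oner_eq0.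
split=> // B C [f [g [hf hg gf fg]]].
have [i [p [j [q [[hi hp hj hq] [pi qj ipjq]]]]]] := osum_biproduct k B C.
(* The idempotent of E(x, y) that projects onto the summand B. *)
pose e := pcomp (pcomp g i) (pcomp p f).
have hgi : hom (pcomp g i) by apply: hom_comp.
have hpf : hom (pcomp p f) by apply: hom_comp.
have hgj : hom (pcomp g j) by apply: hom_comp.
have hqf : hom (pcomp q f) by apply: hom_comp.
have he : hom e by apply: hom_comp.
have [a [ea ua]] := End e he.
(* If u v is the identity and v u is null, then the identity equals u (v u) v and is null. *)
have zeroP D (u : map (E x y) D) (v : map D (E x y)) : hom u -> hom v ->
    steq (pcomp u v) (pid k _) -> null (pcomp v u) -> stable_zero k D.
  move=> hu hv uv vu; apply: steq_null (steq_sym uv) _.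
  have hw : hom (pcomp u v) by apply: hom_comp.
  have := steq_compr hw uv; rewrite pcomp_idl => /steq_sym/steq_null; apply.
  by rewrite -pcompA [pcomp v _]pcompA; apply/null_compl/null_compr.
have retract D (u : map (osum B C) D) v : hom u -> hom v -> pcomp u v = pid k _ ->
    steq (pcomp (pcomp u f) (pcomp g v)) (pid k _).
  move=> hu hv <-; rewrite -pcompA [pcomp f _]pcompA.
  by apply: steq_compl => //; rewrite -[X in steq _ X]pcomp_idl; apply: steq_compr.
have aa : a * a = a.
  apply/esym/ua; have -> : (a * a) *: id_E = pcomp (a *: id_E) (a *: id_E).
    by rewrite !scale_pscale pcompZl pcompZr pcomp_idl -!scale_pscale scalerA.
  have ee : steq (pcomp e e) e.
    rewrite /e -pcompA; apply: steq_compl => //.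
    by rewrite pcompA -[X in steq _ X]pcomp_idl; apply/steq_compr/retract.
  apply: steq_trans (steq_sym ee) _.
  apply: (@steq_trans _ _ _ _ _ _ (pcomp e (a *: id_E))).
    exact: steq_compl.
  by apply: steq_compr => //; apply/homZ/hom_id.
have [a0|a0] := eqVneq a 0.
  left; apply: (zeroP _ (pcomp p f) (pcomp g i)) => //; first exact: retract.
  by move: ea; rewrite a0 scale0r subr0.
right; apply: (zeroP _ (pcomp q f) (pcomp g j)) => //; first exact: retract.
have a1 : a = 1 by apply: (mulfI a0); rewrite mulr1.
(* The idempotents of B and C add up to g f, stably the identity; when a = 1, that of C is null. *)
have eE : e + pcomp (pcomp g j) (pcomp q f) = pcomp g f.
  rewrite /e -!pcompA -pcompDr [pcomp i _]pcompA [pcomp j _]pcompA -pcompDl ipjq.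
  by rewrite pcomp_idl.
have := nullB gf ea; rewrite -eE a1 scale1r opprB subrKA addrAC subrr add0r.
by [].
Qed.

End HomE.

Section Swap.
Variables (R : realType) (k : fieldType) (X : set (circle R)).
Implicit Types (x y z w : X).

Definition swap x y : pmap k (under (E x y)) (under (E y x)) :=
  mono (P := under (E x y)) (Q := under (E y x)) (fun i => (i.1, ~~ i.2)) (fun=> 1).

Lemma swapK x y : pcomp (swap y x) (swap x y) = pid k _.
Proof.
rewrite pcomp_mono; last by case=> i [].
apply/ffunP => -[[l b] [m c]]; rewrite !ffunE mulr1 /= !xpair_eqE negbK.
by case: ifP.
Qed.

Lemma hom_swap x y : x != y -> hom (swap x y).
Proof.
move=> xy; apply/hom_E; rewrite // 1?eq_sym // !ffunE /= !ccxx !ccyy.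
by rewrite !mulr0.
Qed.

Lemma E_swap x y : x != y -> stable_iso k (E x y) (E y x).
Proof.
move=> xy; exists (swap x y), (swap y x); rewrite !swapK !subrr.
by split; [exact: hom_swap|apply: hom_swap; rewrite eq_sym|exact: null0|exact: null0].
Qed.

End Swap.

(** A half-open interval is recovered from the pairs of end points that it separates. If a < c, the
    pair a, c forces b <= c, while the pair a, d forces d < b. If a = c, the pair b, d distinguishes
    the intervals unless b = d. *)
Lemma arc_inj a b c d : (a < b)%N -> (c < d)%N ->
  (forall u v : nat, u \in [:: a; b; c; d] -> v \in [:: a; b; c; d] -> u != v ->
    ((a <= u < b) != (a <= v < b))%N = ((c <= u < d) != (c <= v < d))%N) ->
  a = c /\ b = d.
Proof.
have lt_absurd a' b' c' d' : (a' < b')%N -> (c' < d')%N -> (a' < c')%N ->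
  (forall u v : nat, u \in [:: a'; b'; c'; d'] -> v \in [:: a'; b'; c'; d'] -> u != v ->
    ((a' <= u < b') != (a' <= v < b'))%N = ((c' <= u < d') != (c' <= v < d'))%N) ->
  False.
  move=> ab cd ac H.
  have := H a' c'; have := H a' d'; rewrite !inE !eqxx !orbT /=.
  move=> /(_ isT isT) + /(_ isT isT); clear H; lia.
move=> ab cd H; have [ac|ac|ac] := ltngtP a c.
- by case: (lt_absurd _ _ _ _ ab cd ac H).
- case: (lt_absurd _ _ _ _ cd ab ac) => u v uin vin uv; rewrite H //.
    by move: uin; rewrite !inE => /or4P[] ->; rewrite ?orbT.
  by move: vin; rewrite !inE => /or4P[] ->; rewrite ?orbT.
split=> //; subst c; apply/eqP/negPn/negP => bd.
have := H b d; rewrite !inE !eqxx !orbT => /(_ isT isT bd); clear H; lia.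
Qed.

(** * The vertices of the regular n-gon *)

Section RootsOfUnity.
Variables (R : realType) (n : nat).
Hypothesis n_gt0 : (0 < n)%N.
Local Notation pt := (Zn_pt R n).

(** The last summand adds a full turn when j < i, which brings the angle into [0, 2 pi). *)
Lemma angle_Zn i j : (0 < i <= n)%N -> (0 < j <= n)%N ->
  angle (pt i) (pt j) = 2 * pi * (j%:R - i%:R + n%:R * (j < i)%N%:R) / n%:R.
Proof.
move=> /andP[i0 iN] /andP[j0 jN].
have nR : (0 : R) < n%:R by rewrite ltr0n.
have n0 : n%:R != 0 :> R by rewrite gt_eqF.
have iR : (0 : R) < i%:R by rewrite ltr0n.
have jR : (0 : R) < j%:R by rewrite ltr0n.
have inR : (i%:R : R) <= n%:R by rewrite ler_nat.
have jnR : (j%:R : R) <= n%:R by rewrite ler_nat.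
have p0 := pi_gt0 R.
set m : R := _ - _ + _.
have /andP[m0 mn] : 0 <= m < n%:R.
  rewrite /m; have [ji|ij] := ltnP j i; rewrite /= ?mulr1 ?mulr0 ?addr0.
    have : (j%:R : R) < i%:R by rewrite ltr_nat.
    lra.
  have : (i%:R : R) <= j%:R by rewrite ler_nat.
  lra.
apply: angleE.
  rewrite ltr_pdivrMr // ltr_pM2l ?mn ?mulr_gt0 // andbT.
  by rewrite !mulr_ge0 // ?invr_ge0 ltW.
set a := _ / _; pose b : R := 2 * pi * i%:R / n%:R; pose c : R := 2 * pi * j%:R / n%:R.
rewrite -[val (pt i)]/(cos b, sin b) -[val (pt j)]/(cos c, sin c).
have -> : rot a (cos b, sin b) = (cos (a + b), sin (a + b)).
  by rewrite /rot /= cosD sinD.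
have -> : a + b = c + 2 * pi * (j < i)%N%:R.
  by rewrite /a /b /c /m; field.
case: (j < i)%N; last by rewrite mulr0 addr0.
by rewrite mulr1 mulr_natl cosD2pi sinD2pi.
Qed.

(** In [angleD] divided by 2 pi the index differences cancel and only the full-turn corrections
    remain. *)
Lemma cc_Zn i j l : (0 < i <= n)%N -> (0 < j <= n)%N -> (0 < l <= n)%N ->
  (cc (pt i) (pt j) (pt l) + (l < i) = (j < i) + (l < j))%N.
Proof.
move=> hi hj hl; have := angleD (pt i) (pt j) (pt l).
have n0 : n%:R != 0 :> R by rewrite pnatr_eq0 -lt0n.
have p0 : 2 * pi != 0 :> R by rewrite mulf_neq0 // gt_eqF // pi_gt0.
rewrite !angle_Zn // => H; apply/eqP; rewrite -(eqr_nat R); apply/eqP.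
rewrite !natrD; apply/(addIr (- (l < i)%N%:R))/(mulfI p0); rewrite addrK.
rewrite -[LHS](addKr (2 * pi * (l%:R - i%:R + n%:R * (l < i)%N%:R) / n%:R)) -H.
by field.
Qed.

(** The default 0 lies outside the range 1..n and never occurs, by [Zn_idxP]. *)
Definition Zn_idx (x : Zn R n) : nat :=
  xget 0%N [set j | (0 < j <= n)%N /\ pt j = val x]%classic.

Lemma Zn_idxP x : (0 < Zn_idx x <= n)%N /\ pt (Zn_idx x) = val x.
Proof.
rewrite /Zn_idx; case: xgetP => [j -> //|H]; exfalso.
by have [j jn jx] := set_valP x; apply: (H j).
Qed.

Lemma Zn_idx_inj : injective Zn_idx.
Proof.
move=> x y xy; apply: val_inj.
by rewrite -(Zn_idxP x).2 -(Zn_idxP y).2 xy.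
Qed.

Lemma cc_idx (x y z : Zn R n) : (cc (val x) (val y) (val z) + (Zn_idx z < Zn_idx x) =
  (Zn_idx y < Zn_idx x) + (Zn_idx z < Zn_idx y))%N.
Proof.
have [hx <-] := Zn_idxP x; have [hy <-] := Zn_idxP y; have [hz <-] := Zn_idxP z.
exact: cc_Zn.
Qed.

(** * Stable morphisms and separation of vertices *)

Variable k : fieldType.
Implicit Types (x y z w : Zn R n).
Local Notation i := Zn_idx.
Local Notation map A B := (pmap k (under A) (under B)).

Definition in_arc (a b m : nat) := (minn a b <= m < maxn a b)%N.

Definition separates x y z w := in_arc (i x) (i y) (i z) != in_arc (i x) (i y) (i w).

Lemma separatesC x y z w : separates x y z w = separates x y w z.
Proof. by rewrite /separates eq_sym. Qed.

(** [cc_idx] turns the exponents into comparisons of indices. The two disjuncts say that the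
    diagonal, respectively the off-diagonal, block has nonzero cohomology. *)
Lemma separatesP x y z w : x != y -> z != w ->
  let c a b d := cc (val a) (val b) (val d) in
  separates x y z w =
  ((c x z w + c y w z == 0) || (c x w z + c y z w == 0))%N.
Proof.
move=> xy zw c.
have {}xy : i x != i y by apply: contra xy => /eqP/Zn_idx_inj/eqP.
have {}zw : i z != i w by apply: contra zw => /eqP/Zn_idx_inj/eqP.
have := cc_idx x z w; have := cc_idx y w z; have := cc_idx x w z; have := cc_idx y z w.
rewrite -/(c _ _ _) -/(c _ _ _) -/(c _ _ _) -/(c _ _ _) /separates /in_arc.
move: (c _ _ _) (c _ _ _) (c _ _ _) (c _ _ _) (i x) (i y) (i z) (i w) xy zw.
move=> C1 C2 C3 C4 a b d e.
lia.
Qed.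

Lemma hom_separates x y z w : x != y -> z != w -> separates x y z w ->
  stable_hom_dim k (E x y) (E z w) 1.
Proof.
move=> xy zw; rewrite separatesP // => /orP[] /eqP; set a := cc _ _ _ => ab.
  by apply: stable_hom_dim_E => //; move: ab; rewrite -?/a; lia.
(* Exchanging z and w turns the off-diagonal block into the diagonal one. *)
have wz : w != z by rewrite eq_sym.
apply: (stable_hom_dim_iso (stable_iso_refl k _) (E_swap k wz)).
by apply: stable_hom_dim_E => //; move: ab; rewrite -?/a; lia.
Qed.

Lemma hom_nseparates x y z w : x != y -> z != w -> ~~ separates x y z w ->
  forall f : map (E x y) (E z w), hom f -> null f.
Proof.
move=> xy zw; rewrite separatesP // negb_or -!lt0n => /andP[h1 h2] f.
exact: hom_E_null.
Qed.

Lemma stable_hom_dim10 (A B : obj (Zn R n)) :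
  stable_hom_dim k A B 1 -> ~ stable_hom_dim k A B 0.
Proof.
move=> [b [hb bP]] [b' [_ b'P]].
have nullE (f : map A B) : hom f -> null f.
  by move=> hf; have [c [+ _]] := b'P f hf; rewrite big_ord0 subr0.
have [a [_ ua]] := bP _ (hb ord0).
have aE e : a = e.
  apply: ua; apply: nullE; apply: homB => //.
  by rewrite big_ord1; apply: homZ.
have /rowP/(_ ord0) := aE 0; rewrite (aE (const_mx 1)) !mxE.
by move/eqP; rewrite oner_eq0.
Qed.

Lemma hom_E_dim x y z w : x != y -> z != w ->
  stable_hom_dim k (E x y) (E z w) (separates x y z w).
Proof.
move=> xy zw; case: (boolP (separates x y z w)) => s; first exact: hom_separates.
by apply: stable_hom_dim0; apply: hom_nseparates.
Qed.

Lemma stable_hom_dim_bool (A B : obj (Zn R n)) (b b' : bool) :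
  stable_hom_dim k A B b -> stable_hom_dim k A B b' -> b = b'.
Proof. by case: b; case: b' => // d d'; case: (@stable_hom_dim10 A B). Qed.

Lemma in_arcC a b m : in_arc a b m = in_arc b a m.
Proof. by rewrite /in_arc minnC maxnC. Qed.

(** Stable Hom dimensions into every E(u, v) are isomorphism invariants, so both chords separate the
    same pairs; [arc_inj] recovers their ends. *)
Lemma E_iso_idx x y z w : x != y -> z != w -> stable_iso k (E x y) (E z w) ->
  x = z /\ y = w \/ x = w /\ y = z.
Proof.
move=> xy zw iso.
have sl u v : u != v -> separates x y u v = separates z w u v.
  move=> uv; apply: (@stable_hom_dim_bool (E z w) (E u v)); last exact: hom_E_dim.
  apply: (stable_hom_dim_iso iso (stable_iso_refl k _)); exact: hom_E_dim.
have sr u v : u != v -> separates u v x y = separates u v z w.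
  move=> uv; apply: (@stable_hom_dim_bool (E u v) (E z w)); last exact: hom_E_dim.
  apply: (stable_hom_dim_iso (stable_iso_refl k _) iso); exact: hom_E_dim.
have := sl _ _ xy; have := sr _ _ xy.
suff : i x = i z /\ i y = i w \/ i x = i w /\ i y = i z.
  by case=> -[/(Zn_idx_inj) -> /(Zn_idx_inj) ->]; [left|right].
have ixy : i x != i y by apply: contra xy => /eqP/Zn_idx_inj/eqP.
have izw : i z != i w by apply: contra zw => /eqP/Zn_idx_inj/eqP.
have {}sl u v : i u != i v -> separates x y u v = separates z w u v.
  by move=> uv; apply: sl; apply: contra uv => /eqP ->.
have lt_minmax (u v : nat) : u != v -> (minn u v < maxn u v)%N.
  by lia.
(* The end points of the two arcs are themselves indices of vertices, so they can be tested by
   [sl]. *)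
have idx u : u \in [:: minn (i x) (i y); maxn (i x) (i y);
    minn (i z) (i w); maxn (i z) (i w)] -> exists p, i p = u.
  rewrite !inE /minn /maxn => /or4P[] /eqP ->; case: ifP => _; by eexists.
have := arc_inj (lt_minmax _ _ ixy) (lt_minmax _ _ izw).
case=> [u v /idx[p <-] /idx[q <-]|]; first exact: sl.
clear; move: (i x) (i y) (i z) (i w) => a b c d; lia.
Qed.

(** Chords with exactly one common end separate each other's ends in only one direction; this is the
    total dimension one that compatibility allows. *)
Definition interleaved x y z w := separates x y z w && separates z w x y.

Lemma compatible_E x y z w : x != y -> z != w ->
  compatible k (E x y) (E z w) <-> ~~ interleaved x y z w.
Proof.
move=> xy zw.
have yx : y != x by rewrite eq_sym.
have wz : w != z by rewrite eq_sym.
(* The shift of E(z, w) is E(w, z), and the order of z and w does not affect separation. *)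
have d1 : ext1_dim k (E x y) (E z w) (separates x y z w).
  have := hom_E_dim xy wz; rewrite separatesC; apply.
have d2 : ext1_dim k (E z w) (E x y) (separates z w x y).
  have := hom_E_dim zw yx; rewrite separatesC; apply.
split=> [[n1 [n2 [e1 e2 n12]]]|ni]; last first.
  by exists (separates x y z w), (separates z w x y); split=> //;
    move: ni; rewrite /interleaved;
    case: (separates x y z w); case: (separates _ _ _ _).
apply/negP => /andP[s1 s2]; rewrite s1 in d1; rewrite s2 in d2.
case: n1 e1 n12 => [/(stable_hom_dim10 d1)//|n1] _.
case: n2 e2 => [/(stable_hom_dim10 d2)//|n2] _; lia.
Qed.

End RootsOfUnity.

(** * Crossing chords *)

Section Orientation.
Variable R : realType.
Implicit Types p q r : R * R.

(** Twice the signed area of the triangle, positive when it is counterclockwise. *)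
Definition orient p q r : R :=
  (q.1 - p.1) * (r.2 - p.2) - (q.2 - p.2) * (r.1 - p.1).

Definition comb p q (s : R) : R * R :=
  ((1 - s) * p.1 + s * q.1, (1 - s) * p.2 + s * q.2).

Lemma orient_comb p q z w s :
  orient p q (comb z w s) = (1 - s) * orient p q z + s * orient p q w.
Proof. by rewrite /orient /comb /=; ring. Qed.

Lemma orientl p q : orient p q p = 0.
Proof. by rewrite /orient; ring. Qed.

Lemma orientr p q : orient p q q = 0.
Proof. by rewrite /orient; ring. Qed.

Lemma orient_comb0 p q s : orient p q (comb p q s) = 0.
Proof. by rewrite /orient /comb /=; ring. Qed.

Lemma convex_comb0 (s a b : R) : 0 < s < 1 -> (1 - s) * a + s * b = 0 ->
  (a < 0) = (0 < b) /\ (b < 0) = (0 < a).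
Proof.
move=> /andP[s0 s1] /eqP; rewrite addr_eq0 => /eqP e.
have s1' : 0 < 1 - s by rewrite subr_gt0.
by rewrite -(pmulr_rlt0 a s1') -(pmulr_rgt0 a s1') e oppr_lt0 oppr_gt0
  pmulr_rgt0 // pmulr_rlt0.
Qed.

(** Each segment has its ends strictly on opposite sides of the line through the other, and Cramer's
    rule gives the common point. *)
Lemma segments_meet p q z w : orient p q z < 0 -> 0 < orient p q w ->
  0 < orient z w p -> orient z w q < 0 ->
  exists s s', [/\ 0 < s < 1, 0 < s' < 1 & comb p q s = comb z w s'].
Proof.
move=> pqz pqw zwp zwq.
(* The cross product of the directions q - p and w - z. *)
pose D := orient p q w - orient p q z.
have DE : D = orient z w p - orient z w q by rewrite /D /orient; ring.
have D0 : 0 < D by rewrite /D; lra.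
exists (orient z w p / D), (- orient p q z / D).
rewrite !divr_gt0 ?oppr_gt0 //= !ltr_pdivrMr // !mul1r.
split; [by lra|by rewrite /D; lra|].
have : D != 0 by rewrite gt_eqF.
by rewrite /comb /D /orient => D0'; congr pair; field.
Qed.

(** Doubled angles make the area factor into sines of half the arcs. *)
Lemma orient_circle (a b c : R) :
  orient (cos (a + a), sin (a + a)) (cos (b + b), sin (b + b))
    (cos (c + c), sin (c + c)) = 4 * sin (b - a) * sin (c - b) * sin (c - a).
Proof.
rewrite !cosD !sinD !cosN !sinN.
(* The identity is one of polynomials once the constants 1 are replaced by
   [cos ^+ 2 + sin ^+ 2], which makes it homogeneous. *)
pose N (u : R) := cos u ^+ 2 + sin u ^+ 2.
pose C (u : R) := cos u * cos u - sin u * sin u.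
pose S (u : R) := sin u * cos u + cos u * sin u.
transitivity (N a * (C b * S c - C c * S b) + N b * (C c * S a - C a * S c) +
    N c * (C a * S b - C b * S a)).
  by rewrite /N !cos2Dsin2 /orient /C /S /=; ring.
by rewrite /N /C /S; ring.
Qed.

(** With [h] half the polar angle, the differences lie strictly between 0 and pi, so all three sines
    are positive. *)
Lemma orient_Zn n i j l : (0 < i)%N -> (i < j)%N -> (j < l)%N -> (l <= n)%N ->
  0 < orient (val (Zn_pt R n i)) (val (Zn_pt R n j)) (val (Zn_pt R n l)).
Proof.
move=> i0 ij jl ln; pose h (j : nat) : R := pi * j%:R / n%:R.
have n0 : (0 : R) < n%:R by rewrite ltr0n; lia.
have hE m : val (Zn_pt R n m) = (cos (h m + h m), sin (h m + h m)).
  have -> : h m + h m = 2 * pi * m%:R / n%:R by rewrite /h; field; rewrite gt_eqF.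
  by [].
have sin_gt0 a b : (0 < a)%N -> (a < b)%N -> (b <= n)%N -> 0 < sin (h b - h a).
  move=> a0 ab bn.
  have aR : (0 : R) < a%:R by rewrite ltr0n.
  have abR : (a%:R : R) < b%:R by rewrite ltr_nat.
  have bR : (b%:R : R) <= n%:R by rewrite ler_nat.
  have p0 := pi_gt0 R.
  rewrite /h -mulrBl -mulrBr; apply: sin_gt0_pi.
  rewrite divr_gt0 ?mulr_gt0 ?subr_gt0 //= ltr_pdivrMr // ltr_pM2l //; lra.
rewrite !hE orient_circle !mulr_gt0 ?sin_gt0 //; lia.
Qed.

End Orientation.

Section Crossing.
Variables (R : realType) (n : nat).
Implicit Types x y z w : Zn R n.
Local Notation i := (@Zn_idx R n).
Local Notation co x := (val (val x)).

Lemma orient_idx x y z : (i x < i y)%N -> (i y < i z)%N ->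
  0 < orient (co x) (co y) (co z).
Proof.
move=> xy yz; rewrite -(Zn_idxP x).2 -(Zn_idxP y).2 -(Zn_idxP z).2.
have [/andP[x0 _] _] := Zn_idxP x; have [/andP[_ zn] _] := Zn_idxP z.
exact: orient_Zn.
Qed.

Lemma orient_inside x y z : (i x < i z)%N -> (i z < i y)%N ->
  orient (co x) (co y) (co z) < 0.
Proof. by move=> xz zy; have := orient_idx xz zy; rewrite /orient; lra. Qed.

Lemma orient_outside x y z : (i x < i y)%N -> (i z < i x)%N || (i y < i z)%N ->
  0 < orient (co x) (co y) (co z).
Proof.
move=> xy /orP[zx|yz]; last exact: orient_idx.
by have := orient_idx zx xy; rewrite /orient; lra.
Qed.

Lemma set2_eq (T : Type) (a b c d : T) : [set a; b]%classic = [set c; d]%classic ->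
  a = c /\ b = d \/ a = d /\ b = c.
Proof.
move=> e.
have : [set c; d]%classic a by rewrite -e; left.
have : [set c; d]%classic b by rewrite -e; right.
have : [set a; b]%classic c by rewrite e; left.
have : [set a; b]%classic d by rewrite e; right.
rewrite /=; intuition congruence.
Qed.

Lemma open_segmentE x y p : x <> y ->
  open_segment [set x; y]%classic p <->
  exists2 s : R, 0 < s < 1 & p = comb (co x) (co y) s.
Proof.
move=> xy; split=> [[x' [y' [s [x'y' e s01 ->]]]]|[s s01 ->]].
  case: (set2_eq e) => -[-> ->]; first by exists s.
  exists (1 - s); first by lra.
  by rewrite /comb; congr pair; ring.
by exists x, y, s.
Qed.

(** Both sides amount to strict alternation of the four indices, [ilE]. Without alternation z and w
    lie weakly on one side of the line xy, one of them strictly, so no inner point of zw is on that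
    line. *)
Lemma crossing_interleaved x y z w : (i x < i y)%N -> (i z < i w)%N ->
  [set x; y]%classic <> [set z; w]%classic ->
  (open_segment [set x; y] `&` open_segment [set z; w] !=set0)%classic <->
  interleaved x y z w.
Proof.
move=> xy zw ne.
have nxy : x <> y by move=> e; move: xy; rewrite e ltnn.
have nzw : z <> w by move=> e; move: zw; rewrite e ltnn.
have neq : i x <> i z \/ i y <> i w.
  have [/Zn_idx_inj xz|] := eqVneq (i x) (i z); last by move/eqP; left.
  have [/Zn_idx_inj yw|] := eqVneq (i y) (i w); last by move/eqP; right.
  by case: ne; rewrite xz yw.
have ilE : interleaved x y z w =
    (i x < i z < i y)%N && (i y < i w)%N || (i z < i x < i w)%N && (i w < i y)%N.
  rewrite /interleaved /separates /in_arc; clear -xy zw neq.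
  by move: (i x) (i y) (i z) (i w) xy zw neq => a b c d; lia.
rewrite ilE; split.
  move=> [p [/(open_segmentE _ nxy)[s s01 pE] /(open_segmentE _ nzw)[s' s'01 pE']]].
  apply/negPn/negP => nil.
  (* The common point lies on the line xy, and [orient] is affine along zw. *)
  have Ls : (1 - s') * orient (co x) (co y) (co z) +
      s' * orient (co x) (co y) (co w) = 0.
    by rewrite -orient_comb -pE' pE orient_comb0.
  have in_le v : (i x <= i v <= i y)%N -> orient (co x) (co y) (co v) <= 0.
    move=> /andP[]; have [xv _|//|/Zn_idx_inj <- _ _] := ltngtP (i x) (i v);
      last by rewrite orientl.
    have [vy _|//|/Zn_idx_inj -> _] := ltngtP (i v) (i y);
      last by rewrite orientr.
    exact/ltW/orient_inside.
  have out_ge v : (i v <= i x)%N || (i y <= i v)%N ->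
      0 <= orient (co x) (co y) (co v).
    have [vx _|xv|/Zn_idx_inj -> _] := ltngtP (i v) (i x);
      [by apply/ltW/orient_outside; rewrite ?vx| |by rewrite orientl].
    have [//|yv _|/Zn_idx_inj -> _] := ltngtP (i v) (i y);
      [by apply/ltW/orient_outside; rewrite ?yv ?orbT|by rewrite orientr].
  (* Both ends lie weakly inside or both weakly outside the arc; the strict one is z in the first
     and third cases, w in the others. *)
  have ord : [\/ (i x < i z)%N /\ (i w <= i y)%N, (i x <= i z)%N /\ (i w < i y)%N,
      ((i z < i x) || (i y < i z))%N /\ ((i w <= i x) || (i y <= i w))%N |
      ((i z <= i x) || (i y <= i z))%N /\ ((i w < i x) || (i y < i w))%N].
    clear Ls in_le out_ge.
    have [xz|zx|xz] := ltngtP (i x) (i z).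
    - have [wy|yw] := leqP (i w) (i y); first by constructor 1.
      constructor 4; rewrite ?yw ?orbT; split=> //; apply/orP; right.
      by rewrite leqNgt; apply: contra nil => zy; rewrite xz zy yw.
    - have [wy|yw] := ltnP (i w) (i y); last first.
        by constructor 3; rewrite ?zx ?yw ?orbT.
      constructor 3; rewrite ?zx; split=> //; apply/orP; left.
      by rewrite leqNgt; apply: contra nil => xw; rewrite zx xw wy orbT.
    have [wy|yw|yw] := ltngtP (i w) (i y);
      [by constructor 2| |by case: neq; rewrite ?xz ?yw].
    by constructor 4; rewrite ?xz ?leqnn ?yw ?orbT.
  have [sgz sgw] := convex_comb0 s'01 Ls.
  case: ord => -[h1 h2].
  - have Lw := in_le w; rewrite h2 (ltnW (ltn_trans h1 zw)) leNgt -sgz in Lw.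
    by have := Lw isT; rewrite (orient_inside h1 (leq_trans zw h2)).
  - have Lz := in_le z; rewrite h1 (ltnW (ltn_trans zw h2)) leNgt -sgw in Lz.
    by have := Lz isT; rewrite (orient_inside (leq_ltn_trans h1 zw) h2).
  - by have := out_ge _ h2; rewrite leNgt sgw (orient_outside xy h1).
  by have := out_ge _ h1; rewrite leNgt sgz (orient_outside xy h2).
have meet a b c e : (i a < i c)%N -> (i c < i b)%N -> (i b < i e)%N ->
    exists s s' : R, [/\ 0 < s < 1, 0 < s' < 1 &
      comb (co a) (co b) s = comb (co c) (co e) s'].
  move=> ac cb be; apply: segments_meet.
  - exact: orient_inside.
  - by apply: orient_outside; rewrite ?be ?orbT ?(ltn_trans ac).
  - by apply: orient_outside; rewrite ?ac ?(ltn_trans cb).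
  - exact: orient_inside.
case/orP=> /andP[/andP[h1 h2] h3].
  have [s [s' [s01 s'01 e]]] := meet _ _ _ _ h1 h2 h3.
  exists (comb (co x) (co y) s); split; apply/open_segmentE => //; first by exists s.
  by exists s'.
have [s [s' [s01 s'01 e]]] := meet _ _ _ _ h1 h2 h3.
exists (comb (co x) (co y) s'); split; apply/open_segmentE => //; first by exists s'.
by exists s.
Qed.

(** Both relations are insensitive to the order of the ends of a chord, so the indices may be taken
    increasing. *)
Lemma crossingP x y z w : x != y -> z != w ->
  crossing [set x; y]%classic [set z; w]%classic <->
  [set x; y]%classic <> [set z; w]%classic /\ interleaved x y z w.
Proof.
have ilCl (a b c e : Zn R n) : interleaved a b c e = interleaved b a c e.
  by rewrite /interleaved (separatesC c) /separates !(in_arcC (i a)).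
have ilCr (a b c e : Zn R n) : interleaved a b c e = interleaved a b e c.
  by rewrite /interleaved andbC [RHS]andbC; apply: ilCl.
move=> xy zw; wlog xyi : x y xy / (i x < i y)%N.
  move=> H; have [lt|lt|/Zn_idx_inj e] := ltngtP (i x) (i y); first exact: H.
    by rewrite setUC ilCl; apply: H => //; rewrite eq_sym.
  by rewrite e eqxx in xy.
wlog zwi : z w zw / (i z < i w)%N.
  move=> H; have [lt|lt|/Zn_idx_inj e] := ltngtP (i z) (i w); first exact: H.
    by rewrite [[set z; w]%classic]setUC ilCr; apply: H => //; rewrite eq_sym.
  by rewrite e eqxx in zw.
by split=> -[ne /(crossing_interleaved xyi zwi ne)].
Qed.

End Crossing.

(** * Clusters and triangulations *)

Section ClusterTriangulation.
Local Open Scope classical_set_scope.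
Variables (R : realType) (k : fieldType) (n : nat).
Hypothesis n_gt0 : (0 < n)%N.
Implicit Types (x y z w : Zn R n) (C : set (obj (Zn R n))) (T : set (set (Zn R n))).

Definition edges_of C : set (set (Zn R n)) :=
  [set e | exists x y, [/\ x != y, e = [set x; y] & C (E x y)]].

Definition objects_of T : set (obj (Zn R n)) :=
  [set A | exists x y, [/\ x != y, T [set x; y] & stable_iso k A (E x y)]].

Lemma E_isoP x y z w : x != y -> z != w ->
  stable_iso k (E x y) (E z w) <-> [set x; y] = [set z; w].
Proof.
move=> xy zw; split=> [/(E_iso_idx n_gt0 xy zw)|e].
  by case=> -[-> ->] //; rewrite setUC.
case: (set2_eq e) => -[-> ->]; first exact: stable_iso_refl.
by apply: E_swap; rewrite eq_sym.
Qed.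

Lemma edges_of_noncrossing C : compatible_collection k C -> noncrossing (edges_of C).
Proof.
move=> [_ _ compC]; split=> [e [x [y [/eqP xy -> _]]]|]; first by exists x, y.
move=> e e' [x [y [xy -> Cxy]]] [z [w [zw -> Czw]]].
move=> /(crossingP xy zw)[ne]; apply/negP/(compatible_E n_gt0 k xy zw).
by apply: compC => //; rewrite E_isoP.
Qed.

Lemma objects_of_compatible T : noncrossing T -> compatible_collection k (objects_of T).
Proof.
move=> [_ ncT]; split.
- move=> A [x [y [xy _ Axy]]].
  by apply: (indecomposable_iso (stable_iso_sym Axy)); apply: indecomposable_Exy.
- move=> A B [x [y [xy Txy Axy]]] AB; exists x, y; split=> //.
  exact: stable_iso_trans (stable_iso_sym AB) Axy.
move=> A B [x [y [xy Txy Axy]]] [z [w [zw Tzw Bzw]]] nAB.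
apply: (compatible_iso (stable_iso_sym Axy) (stable_iso_sym Bzw)).
apply/(compatible_E n_gt0 k xy zw)/negP => il.
apply: (ncT _ _ Txy Tzw); apply/(crossingP xy zw); split=> //.
move=> /(E_isoP xy zw) iso; apply/nAB/(stable_iso_trans Axy)/(stable_iso_trans iso).
exact: stable_iso_sym.
Qed.

Lemma edges_ofP C x y : compatible_collection k C -> x != y ->
  edges_of C [set x; y] <-> C (E x y).
Proof.
move=> [_ isoC _] xy; split=> [[z [w [zw e Czw]]]|Cxy]; last by exists x, y.
by apply: isoC Czw _; apply/E_isoP.
Qed.

(** Every indecomposable is isomorphic to some E(x, y) with x <> y, and the collection is closed
    under isomorphism. *)
Lemma edges_ofK C : compatible_collection k C -> objects_of (edges_of C) = C.
Proof.
move=> CC; have [indC isoC _] := CC; apply/seteqP; split=> A.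
  move=> [x [y [xy /(edges_ofP CC xy) Cxy Axy]]].
  exact: isoC Cxy (stable_iso_sym Axy).
move=> CA; have [x [y [/eqP xy Axy]]] := indecomposable_E (indC _ CA).
by exists x, y; split=> //; apply/edges_ofP => //; apply: isoC Axy.
Qed.

Lemma objects_ofK T : noncrossing T -> edges_of (objects_of T) = T.
Proof.
move=> [edgeT _]; apply/seteqP; split=> e.
  by move=> [x [y [xy -> [z [w [zw Tzw /(E_isoP xy zw) ->]]]]]].
move=> Te; have [x [y [/eqP xy eE]]] := edgeT _ Te; subst e.
by exists x, y; split=> //; exists x, y; split=> //; apply: stable_iso_refl.
Qed.

Lemma edges_ofS C D : C `<=` D -> edges_of C `<=` edges_of D.
Proof. by move=> CD e [x [y [xy -> /CD ?]]]; exists x, y. Qed.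

Lemma objects_ofS S T : S `<=` T -> objects_of S `<=` objects_of T.
Proof. by move=> ST A [x [y [xy /ST ? ?]]]; exists x, y. Qed.

(** [edges_of] and [objects_of] are mutually inverse and preserve inclusion, so maximality is
    transported. *)
Lemma edges_of_cluster C : is_cluster k C -> triangulation (edges_of C).
Proof.
move=> [CC maxC]; split=> [|T ncT CT]; first exact: edges_of_noncrossing.
rewrite -(objects_ofK ncT) (maxC (objects_of T)) //; first exact: objects_of_compatible.
by rewrite -(edges_ofK CC); apply: objects_ofS.
Qed.

Lemma objects_of_triangulation T : triangulation T -> is_cluster k (objects_of T).
Proof.
move=> [ncT maxT]; split=> [|D CD TD]; first exact: objects_of_compatible.
rewrite -(edges_ofK CD) (maxT (edges_of D)) //; first exact: edges_of_noncrossing.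
by rewrite -(objects_ofK ncT); apply: edges_ofS.
Qed.

End ClusterTriangulation.

Theorem proposition3p9 (R : realType) (k : fieldType) (n : nat)
    (hn : (3 <= n)%N) :
  exists Phi : set (obj (Zn R n)) -> set (set (Zn R n)),
    set_bij [set C | is_cluster k C]%classic [set T | triangulation T]%classic Phi /\
    forall C : set (obj (Zn R n)), is_cluster k C ->
    forall x y : Zn R n, x <> y -> (Phi C [set x; y]%classic <-> C (E x y)).
Proof.
have n0 : (0 < n)%N by apply: leq_trans hn.
exists (@edges_of R n); split; last first.
  by move=> C [CC _] x y /eqP xy; apply: (edges_ofP n0 CC xy).
split=> [C clC|C D /set_mem[CC _] /set_mem[CD _] eCD|T [ncT maxT]].
- exact: edges_of_cluster clC.
- by rewrite -(edges_ofK n0 CC) -(edges_ofK n0 CD) eCD.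
exists (objects_of k T); first exact: objects_of_triangulation (conj ncT maxT).
exact: objects_ofK.
Qed.
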